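(* Let $G$ be a finite group with $G=AB$, where $A$ is a subnormal subgroup of $G$ and $B$ is a supersoluble Hall subgroup of $G$ all of whose Sylow subgroups are cyclic. If every maximal subgroup of every non-cyclic Sylow subgroup of $A$ is $\mathfrak{U}_{\mathrm s}$-quasinormal in $G$, where $\mathfrak{U}$ is the class of all finite supersoluble groups, then $G$ is supersoluble.
   Context: All groups are finite. A subgroup $H$ of $G$ is $s$-permutable in $G$ if $HQ=QH$ for every Sylow subgroup $Q$ of $G$ (for every prime). $H_G$ denotes the largest normal subgroup of $G$ contained in $H$. Let $\mathfrak{F}$ be a non-empty class of groups. A chief factor $H/K$ of a group $G$ is $\mathfrak{F}$-central if the semidirect product $[H/K](G/C_G(H/K))$ (with $G/C_G(H/K)$ acting on $H/K$ by conjugation) belongs to $\mathfrak{F}$. The $\mathfrak{F}$-hypercenter $Z_\infty^{\mathfrak{F}}(G)$ is the product of all normal subgroups $N$ of $G$ such that every $G$-chief factor of $N$ (i.e. every chief factor of $G$ below $N$) is $\mathfrak{F}$-central. A subgroup $H$ of $G$ is $\mathfrak{F}_{\mathrm s}$-quasinormal in $G$ if there exists a normal subgroup $T$ of $G$ such that $HT$ is $s$-permutable in $G$ and $(H\cap T)H_G/H_G\leq Z_\infty^{\mathfrak{F}}(G/H_G)$. Taking $\mathfrak{F}=\mathfrak{U}$ gives the notion of $\mathfrak{U}_{\mathrm s}$-quasinormal subgroup. *)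

(* Defs.v *)
From mathcomp Require Import all_boot all_fingroup all_solvable.

Set Implicit Arguments.
Unset Strict Implicit.
Unset Printing Implicit Defensive.

Local Open Scope group_scope.

Definition group_class := forall gT : finGroupType, {group gT} -> bool.

(* U / V is a cyclic factor of two normal subgroups of G (U lies below G as   *)
(* soon as the factor occurs in a chain ending at G).                         *)
Definition cyclic_invariant_factor (gT : finGroupType) (G V U : {set gT}) :=
  invariant_factor G V U && cyclic (U / V).

(* There is a chain 1 = G_0 <= ... <= G_n = G of normal subgroups of G with   *)
(* cyclic factors. Such chains may be taken of any length since connect is    *)
(* the reflexive transitive closure of a relation on the finType {group gT}.  *)
Definition supersoluble : group_class := fun gT G =>
  connect [rel V U : {group gT} | cyclic_invariant_factor G V U] 1%G G.

Lemma supersolubleP (gT : finGroupType) (G : {group gT}) :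
  reflect (exists2 s : seq {group gT},
             path [rel V U : {group gT} | cyclic_invariant_factor G V U] 1%G s
             & last 1%G s = G)
          (supersoluble G).
Proof. by apply: (iffP connectP) => -[s]; exists s. Qed.

Section ChiefFactor.

Variables (gT : finGroupType) (G K H : {group gT}).
Hypothesis chiefHK : chief_factor G K H.

(* 'Q is the conjugation action of 'N(K) on cosets of K, so that              *)
(* 'C_G(H / K | 'Q) is C_G(H/K); G / C_G(H/K) acts on H/K through 'Q %% C.    *)
Lemma chief_factor_acts :
  {acts G / 'C_G(H / K | 'Q), on group H / K | 'Q %% 'C_G(H / K | 'Q)}.
Proof.
have [/maxgroupp/andP[_ nKG] /andP[_ nHG]] := andP chiefHK.
have sCC : 'C_G(H / K | 'Q) \subset 'C(H / K | 'Q) by apply: subsetIr.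
split; first by rewrite astabs_mod ?quotientS ?actsQ.
rewrite subsetI; apply/andP; split; first exact: quotientS (subsetT H).
by rewrite -astabCin ?subsetIl // subIset ?sCC ?orbT.
Qed.

(* The external semidirect product [H/K](G/C_G(H/K)). *)
Definition chief_sdprod : {group sdprod_by <[chief_factor_acts]>%gact} :=
  [set: sdprod_by <[chief_factor_acts]>%gact]%G.

Lemma chief_actE x g : x \in H / K -> g \in G ->
  <[chief_factor_acts]>%act x (coset 'C_G(H / K | 'Q) g) = x ^ coset K g.
Proof.
move=> HKx Gg; have [actGC sHKC] := chief_factor_acts.
have [/maxgroupp/andP[_ nKG] /andP[_ nHG]] := andP chiefHK.
have nCG : G \subset 'N('C_G(H / K | 'Q)).
  by rewrite normsI ?normG // (subset_trans _ (astab_norm _ _)) ?actsQ.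
have /setIP[_ fixx] := subsetP sHKC x HKx.
have nKg := subsetP nKG g Gg.
have domg : g \in qact_dom 'J K by rewrite dom_qactJ.
rewrite actbyE ?mem_quotient //= modactE ?(subsetP nCG) //.
by rewrite (qactJ x g) nKg.
Qed.

End ChiefFactor.

(* H / K is an F-central chief factor of G; the product is only defined given *)
(* a proof that H / K is a chief factor.                                      *)
Definition class_central (F : group_class) (gT : finGroupType)
    (G K H : {group gT}) : bool :=
  if @idP (chief_factor G K H) is ReflectT chHK then F _ (chief_sdprod chHK)
  else false.

Lemma class_centralE F gT (G K H : {group gT}) (chHK : chief_factor G K H) :
  class_central F G K H = F _ (chief_sdprod chHK).
Proof.
rewrite /class_central; case: {-}_ / idP => // chHK'.
by rewrite (bool_irrelevance chHK' chHK).
Qed.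

Section Hypercenter.

Variables (F : group_class) (gT : finGroupType).
Implicit Types G H N : {group gT}.

Definition hypercentral G N : bool :=
  (N <| G) && [forall K : {group gT}, forall H : {group gT},
    chief_factor G K H && (H \subset N) ==> class_central F G K H].

Definition class_hypercenter G : {group gT} :=
  (\prod_(N : {group gT} | hypercentral G N) N)%G.

End Hypercenter.

(* Applied below to a product H * T with T <| G, which is a group. *)
Definition s_permutable (gT : finGroupType) (G : {group gT}) (A : {set gT}) :=
  (A \subset G) && [forall Q : {group gT}, Sylow G Q ==> (A * Q == Q * A)].

(* gcore H G is H_G. *)
Definition s_quasinormal (F : group_class) (gT : finGroupType)
    (G H : {group gT}) : bool :=
  (H \subset G) && [exists T : {group gT},
    [&& T <| G, s_permutable G (H * T)
      & ((H :&: T) * gcore H G) / gcore H G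
          \subset class_hypercenter F (G / gcore H G)]].

(* Main.v *)
Require Import Defs.
From mathcomp Require Import all_boot all_fingroup all_algebra all_solvable.
From mathcomp Require Import all_field all_character.

Set Implicit Arguments.
Unset Strict Implicit.
Unset Printing Implicit Defensive.

Local Open Scope group_scope.
Import GRing.Theory FiniteModule.

(** Let P be a non-cyclic Sylow p-subgroup of G. As B is a Hall subgroup with
    cyclic Sylow subgroups, p does not divide the order of B, hence not the
    index of A, which divides #|B|; a subnormal subgroup of index prime to p
    contains every p-subgroup, so P is a Sylow subgroup of A. Thus the maximal
    subgroups of all non-cyclic Sylow subgroups of G are quasinormal in the
    sense of the hypothesis, and A and B can be forgotten.

    Supersolubility is handled through chief factors: [prime_chief G V U] says
    that the chief factors of G between V and U have prime order. It holds
    below the hypercenter, because a chief factor H / K that is central for the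
    supersoluble class is a minimal normal subgroup of a supersoluble
    semidirect product. On the other hand, if M * T is s-permutable then the
    p-group M * T / T is normalised by the Sylow q-subgroups of G / T for all q
    other than p; a maximal subgroup M of P is normalised by P as well, so
    M * T is normal. The hypothesis on M becomes [reduced_quasinormal]: there
    are normal subgroups T, Z and C of G with M * T normal, C inside M,
    M :&: T inside Z, and chief factors of prime order from C to Z. In this
    form it passes to the quotients and normal Hall subgroups that induction
    calls for.

    The heart of the matter is [monolith_prime]. Let N be a minimal normal
    p-subgroup that every non-trivial normal subgroup contains, and let M be a
    maximal subgroup of P not containing N. Then C is trivial, and T is not,
    as otherwise M would be normal, hence trivial, and P cyclic. So N lies in
    T. Either Z is non-trivial, and N is a chief factor below Z; or M meets T,
    hence N, trivially, and N has order #|P : M|. In both cases #|N| = p. The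
    remaining possibility, N inside 'Phi(P), is one in which a Frattini
    argument carries 'O_p^'(G) = 1 over to G / N.

    This is used twice. If p is the smallest prime divisor of #|G|, induction
    gives that G / N is p-nilpotent, and a normal subgroup of order p is then
    central: G is p-nilpotent ([smallest_p_nilpotent]; the cyclic case is
    Burnside's transfer argument). Its normal p-complement satisfies the same
    hypotheses, so is supersoluble by induction, and G is soluble. For soluble
    G ([solvable_prime_chief]) induction gives G / N supersoluble, and it
    remains to see that #|N| = p when N is inside 'Phi(P). Now 'O_p(G / N)
    contains its own centraliser, which makes G / 'O_p(G) abelian of exponent
    dividing p - 1 ([prime_chief_pcore_exponent]); as 'O_p(G) centralises N,
    all eigenvalues of G on N lie in 'F_p and the irreducible module N is
    one-dimensional ([minnormal_exponent_prime]). *)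

(** * Chief factors *)

Section ChiefFactors.

Variable gT : finGroupType.
Implicit Types G H K L N U V W : {group gT}.

Lemma chiefP G K H :
  reflect [/\ K <| G, H <| G, K \proper H
            & forall L, L <| G -> K \subset L -> L \subset H ->
                L :=: K \/ L :=: H]
          (chief_factor G K H).
Proof.
apply: (iffP andP) => [[/maxgroupP[/andP[prKH nKG] maxK] nsHG]
                      | [nsKG nsHG prKH maxK]].
  split=> // [|L /andP[_ nLG] sKL sLH].
    by rewrite /normal nKG (subset_trans (proper_sub prKH)) ?normal_sub.
  have [->|neLH] := eqVneq (L : {set gT}) H; first by right.
  by left; rewrite (maxK L) // properEneq neLH sLH.
split=> //; apply/maxgroupP; split=> [|L /andP[prLH nLG] sKL].
  by rewrite prKH normal_norm.
have sLH := proper_sub prLH.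
case: (maxK L) => // [|eLH]; last by rewrite eLH properxx in prLH.
by rewrite /normal nLG (subset_trans sLH) ?normal_sub.
Qed.

Lemma chief_exists G V U :
    V <| G -> U <| G -> V \proper U ->
  exists2 K : {group gT}, chief_factor G K U & V \subset K.
Proof.
move=> nsVG nsUG prVU.
have [|K maxK sVK] := @maxgroup_exists _ (fun K => (K \proper U) && (G \subset 'N(K))) V.
  by rewrite prVU normal_norm.
by exists K => //; rewrite /chief_factor /maxnormal maxK.
Qed.

Lemma chief_minnormal G N : N \subset G -> chief_factor G 1 N = minnormal N G.
Proof.
move=> sNG; apply/chiefP/mingroupP=> [[_ /andP[_ nNG] prN minN] | [/andP[ntN nNG] minN]].
  split=> [|L /andP[ntL nLG] sLN].
    by rewrite nNG -proper1G prN.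
  have nsLG : L <| G by rewrite /normal nLG (subset_trans sLN).
  by case: (minN L nsLG (sub1G _) sLN) => // L1; rewrite L1 eqxx in ntL.
split=> [||| L /andP[_ nLG] _ sLN]; first exact: normal1.
- by rewrite /normal sNG.
- by rewrite proper1G.
by have [->|ntL] := eqVneq (L : {set gT}) 1; [left | right; rewrite (minN L) ?ntL].
Qed.

(** When W covers part of H / K, minimality forces (H :&: W) * K = H, so the
    factor is G-isomorphic to one inside W. W is taken to
    be G-invariant rather than normal in G so that it may be a term of a series
    of some larger group. *)
Lemma chief_factor_setI G K H W :
    chief_factor G K H -> G \subset 'N(W) -> ~~ (H :&: W \subset K) ->
  chief_factor G (K :&: W)%G (H :&: W)%G /\ #|H :&: W : K :&: W| = #|H : K|.
Proof.
case/chiefP=> nsKG nsHG prKH maxK nWG nsub.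
have [sKG nKG] := andP nsKG; have [sHG nHG] := andP nsHG.
have sKH := proper_sub prKH.
have nKHW : H :&: W \subset 'N(K).
  by rewrite (subset_trans (subsetIl _ _)) ?(subset_trans sHG).
have nsI (X : {group gT}) : X <| G -> X :&: W <| G.
  by case/andP=> sXG nXG; rewrite /normal subIset ?sXG // normsI.
have defH : K * (H :&: W) = H.
  rewrite -norm_joinEr //; have [|||eqK|-> //] := maxK (K <*> (H :&: W))%G.
  - by rewrite normalY ?nsI.
  - exact: joing_subl.
  - by rewrite join_subG sKH subsetIl.
  by rewrite -eqK joing_subr in nsub.
split; last first.
  rewrite -[in RHS]defH indexMg -[RHS]indexgI setIAC.
  by rewrite (setIidPr sKH).
apply/chiefP; split; try exact: nsI.
  rewrite properE setSI //; apply: contra nsub => sub.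
  by apply: subset_trans sub (subsetIl _ _).
move=> L nsLG sKWL; rewrite subsetI => /andP[sLH sLW].
have nKL : L \subset 'N(K) by rewrite (subset_trans (normal_sub nsLG)).
have [|||eqK|eqH] := maxK (K <*> L)%G.
- by rewrite normalY.
- exact: joing_subl.
- by rewrite join_subG sKH.
- left; apply/eqP; rewrite eqEsubset sKWL andbT subsetI sLW andbT.
  by rewrite -eqK joing_subr.
right; apply/eqP; rewrite eqEsubset subsetI sLH sLW /=.
rewrite -eqH /= norm_joinEr // setIC -group_modr //.
by rewrite setIC mul_subG.
Qed.

(** The complementary case of [chief_factor_setI]: H :&: W inside K means that
    W avoids H / K, which then survives unchanged above W. *)
Lemma chief_factor_joing G K H W :
    chief_factor G K H -> W <| G -> H :&: W \subset K ->
  chief_factor G (K <*> W)%G (H <*> W)%G /\ #|H <*> W : K <*> W| = #|H : K|.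
Proof.
case/chiefP=> nsKG nsHG prKH maxK nsWG sub.
have [sKG nKG] := andP nsKG; have [sHG nHG] := andP nsHG; have [sWG nWG] := andP nsWG.
have sKH := proper_sub prKH.
have eKW : K <*> W = K * W by rewrite norm_joinEr ?(subset_trans sWG).
have eHW : H <*> W = H * W by rewrite norm_joinEr ?(subset_trans sWG).
have HKW : H :&: (K <*> W) = K.
  rewrite eKW setIC -group_modl // [W :&: H]setIC.
  by apply/mulGidPl.
have idx : #|H <*> W : K <*> W| = #|H : K|.
  have -> : H <*> W = (K <*> W) * H.
    rewrite eKW eHW -mulgA -(normC (subset_trans sHG nWG)) mulgA.
    by rewrite (mulSGid sKH).
  by rewrite indexMg -indexgI HKW.
split=> //; apply/chiefP; split; try exact: normalY.
  rewrite properE genS ?setSU //=.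
  apply: contraTN prKH => sub'; rewrite properE sKH /= negbK.
  by rewrite -HKW subsetI subxx (subset_trans (joing_subl H W)).
move=> L nsLG; rewrite !join_subG => /andP[sKL sWL] sLHW.
have [|||eqK|eqH] := maxK (L :&: H)%G.
- exact: normalI.
- by rewrite subsetI sKL.
- exact: subsetIr.
- left; rewrite /= eKW -eqK /= group_modr // -eHW.
  by apply/esym/setIidPl.
right; apply/eqP; rewrite eqEsubset sLHW join_subG sWL andbT.
by rewrite -eqH subsetIl.
Qed.

Lemma minnormal_TI G N (Y : {group gT}) :
  minnormal N G -> Y <| G -> ~~ (N \subset Y) -> N :&: Y = 1.
Proof.
case/mingroupP=> /andP[_ nNG] minN nsYG; apply: contraNeq => ntNY.
rewrite -(minN (N :&: Y)%G) ?subsetIl ?subsetIr //.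
by rewrite ntNY normsI ?(normal_norm nsYG).
Qed.

(** Every subgroup of a cyclic group is characteristic, hence normal in G. *)
Lemma minnormal_cyclic_prime G N : minnormal N G -> cyclic N -> prime #|N|.
Proof.
case/mingroupP=> /andP[ntN nNG] minN cycN.
have [p_pr pdv] : prime (pdiv #|N|) /\ (pdiv #|N| %| #|N|).
  by rewrite pdiv_prime ?pdiv_dvd // cardG_gt1.
have [x Nx ox] := Cauchy p_pr pdv.
have sxN : <[x]> \subset N by rewrite cycle_subG.
rewrite -(minN <[x]>%G) //=; first by rewrite -orderE ox.
rewrite -cardG_gt1 -orderE ox prime_gt1 //=.
by apply: char_norm_trans nNG; rewrite sub_cyclic_char /=.
Qed.

End ChiefFactors.

(** * Intervals with chief factors of prime order *)

Section PrimeChief.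

Variable gT : finGroupType.
Implicit Types G H K L N U V W : {group gT}.

Lemma chief_cyclic_prime G K H : chief_factor G K H -> cyclic (H / K) -> prime #|H : K|.
Proof.
move=> chHK cycHK; have/chiefP[nsKG nsHG _ _] := chHK.
rewrite -card_quotient ?(subset_trans (normal_sub nsHG)) ?normal_norm //.
exact: minnormal_cyclic_prime (chief_factor_minnormal chHK) cycHK.
Qed.

(** Supersolubility of G, relative to an interval of its normal subgroups. *)
Definition prime_chief G V U : Prop :=
  forall K H, chief_factor G K H -> V \subset K -> H \subset U -> prime #|H : K|.

Lemma prime_chief_refl G V U : U \subset V -> prime_chief G V U.
Proof.
move=> sUV K H /chiefP[_ _ prKH _] sVK sHU.
have sHK := subset_trans sHU (subset_trans sUV sVK).
by have := proper_sub_trans prKH sHK; rewrite properxx.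
Qed.

Lemma prime_chiefS G V V1 U U1 :
  V \subset V1 -> U1 \subset U -> prime_chief G V U -> prime_chief G V1 U1.
Proof.
move=> sV sU pc K H ch sVK sHU.
exact: pc ch (subset_trans sV sVK) (subset_trans sHU sU).
Qed.

(** Each chief factor of G is covered or avoided by W. *)
Lemma prime_chief_trans G V W U :
  W <| G -> prime_chief G V W -> prime_chief G W U -> V \subset W -> W \subset U ->
  prime_chief G V U.
Proof.
move=> nsWG pcVW pcWU sVW sWU K H ch sVK sHU.
have [sHWK|nsub] := boolP (H :&: W \subset K).
  have [ch' <-] := chief_factor_joing ch nsWG sHWK.
  by apply: pcWU ch' _ _; rewrite ?joing_subr // join_subG sHU.
have [ch' <-] := chief_factor_setI ch (normal_norm nsWG) nsub.
by apply: pcVW ch' _ _; rewrite ?subsetIr // subsetI sVK.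
Qed.

(** A chief factor between V <*> N and U <*> N is covered by U: were it avoided,
    the modular law would give H = (H :&: U) * N, a subgroup of K. *)
Lemma prime_chief_join G V U N :
    V \subset U -> U <| G -> N <| G -> prime_chief G V U ->
  prime_chief G (V <*> N)%G (U <*> N)%G.
Proof.
move=> sVU nsUG nsNG pc K H ch; rewrite join_subG => /andP[sVK sNK] sHUN.
have/chiefP[nsKG nsHG prKH _] := ch; have sKH := proper_sub prKH.
have nsub : ~~ (H :&: U \subset K).
  apply: contraL prKH => sub; rewrite properE negb_and negbK; apply/orP; right.
  have nUN : N \subset 'N(U) by rewrite (subset_trans (normal_sub nsNG)) ?normal_norm.
  rewrite /= norm_joinEr // in sHUN; rewrite -(setIidPl sHUN).
  by rewrite -group_modr ?mul_subG // (subset_trans sNK).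
have [ch' <-] := chief_factor_setI ch (normal_norm nsUG) nsub.
by apply: pc ch' _ _; rewrite ?subsetIr // subsetI sVK.
Qed.

Local Notation chain G := [rel V U : {group gT} | cyclic_invariant_factor G V U].

(** The last term W of the chain either covers the chief factor, which is then
    pushed down into the shorter chain, or avoids it, and the factor is a
    quotient of a subgroup of the top cyclic factor. The terms of the chain are
    only G-invariant, not subgroups of G, as [prime_chief_subG] needs. *)
Lemma chain_prime_chief G V U :
  connect (chain G) V U -> V \subset U /\ prime_chief G V U.
Proof.
case/connectP=> s; elim/last_ind: s U => [|s U1 IHs] U /=.
  by move=> _ ->; split=> //; apply: prime_chief_refl.
rewrite rcons_path last_rcons => /andP[/IHs{}IHs /andP[inv cyc]] ->.
set W := last V s in IHs inv cyc; have{inv} /and3P[nWG nUG nsWU] := inv.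
have{IHs} [sVW IHs] := IHs W erefl; have [sWU nWU] := andP nsWU.
split=> [|K H ch sVK sHU]; first exact: subset_trans sVW sWU.
have [sHWK|nsub] := boolP (H :&: W \subset K); last first.
  have [ch' <-] := chief_factor_setI ch nWG nsub.
  by apply: IHs ch' _ _; rewrite ?subsetIr // subsetI sVK.
apply: (chief_cyclic_prime ch); have /chiefP[/andP[sKG nKG] /andP[sHG nHG] prKH _] := ch.
have nWH := subset_trans sHU nWU.
have /isogP[f injf imf] := second_isog nWH.
have cycHI : cyclic (H / (W :&: H)).
  by rewrite -(injm_cyclic injf) // imf (cyclicS _ cyc) // quotientS.
have nIH : H \subset 'N(W :&: H) by rewrite normsI ?normG.
have sIK : W :&: H \subset K by rewrite setIC.
have nsKH : K <| H by rewrite /normal (proper_sub prKH) (subset_trans sHG).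
have nsIH : W :&: H <| H by rewrite /normal subsetIr.
have /isogP[g injg img] := third_isog sIK nsIH nsKH.
by rewrite -img morphim_cyclic // quotient_cyclic.
Qed.

Lemma prime_chief_chain G V U :
    V <| G -> U <| G -> V \subset U -> prime_chief G V U ->
  connect (chain G) V U.
Proof.
have [m] := ubnP #|U|; elim: m U => // m IHm U leUm nsVG nsUG sVU pc.
have [eVU|prVU] := eqVproper sVU.
  by have -> : U = V by [apply: group_inj]; apply: connect0.
have [K chKU sVK] := chief_exists nsVG nsUG prVU.
have /chiefP[nsKG _ prKU _] := chKU.
have nsKU : K <| U.
  by rewrite /normal proper_sub // (subset_trans (normal_sub nsUG)) ?normal_norm.
apply: (connect_trans (IHm K _ nsVG nsKG sVK _)).
- exact: leq_trans (proper_card prKU) leUm.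
- by apply: prime_chiefS pc; rewrite // proper_sub.
apply: connect1; rewrite /= /cyclic_invariant_factor /invariant_factor.
rewrite !normal_norm //= nsKU prime_cyclic // card_quotient ?normal_norm //.
exact: pc.
Qed.

(** Chief factors of G need not stay chief under K, but a chain of G-invariant
    subgroups with cyclic factors is also K-invariant. *)
Lemma prime_chief_subG G K V U :
    V <| G -> U <| G -> V \subset U -> K \subset G -> prime_chief G V U ->
  prime_chief K V U.
Proof.
move=> nsVG nsUG sVU sKG pc.
suff /chain_prime_chief[] : connect (chain K) V U by [].
apply: connect_sub (prime_chief_chain nsVG nsUG sVU pc) => V1 U1.
case/andP=> /and3P[nV nU nsVU] cyc; apply: connect1.
by rewrite /= /cyclic_invariant_factor /invariant_factor !(subset_trans sKG) //= nsVU.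
Qed.

Lemma supersoluble_prime_chief G : supersoluble G <-> prime_chief G 1%G G.
Proof.
split=> [/chain_prime_chief[] // | pc].
by apply: prime_chief_chain; rewrite ?normal1 ?normal_refl ?sub1G.
Qed.

End PrimeChief.

Section PrimeChiefQuotient.

Variable gT : finGroupType.
Implicit Types G H K L N U V W : {group gT}.

Lemma chief_factor_cosetpre G N (Kb Hb : {group coset_of N}) :
    N <| G -> chief_factor (G / N) Kb Hb ->
  chief_factor G (coset N @*^-1 Kb) (coset N @*^-1 Hb)
  /\ #|coset N @*^-1 Hb : coset N @*^-1 Kb| = #|Hb : Kb|.
Proof.
move=> nsNG /chiefP[nsKG nsHG prKH maxK].
have sKH := proper_sub prKH; have nNG := normal_norm nsNG.
split; last first.
  by rewrite index_morphpre // ?sub_im_coset.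
apply/chiefP; split.
- by rewrite -(quotientGK nsNG) cosetpre_normal.
- by rewrite -(quotientGK nsNG) cosetpre_normal.
- by rewrite cosetpre_proper.
move=> L nsLG sKL sLH.
have sNL : N \subset L by apply: subset_trans sKL; apply: sub_cosetpre.
have nsNL := normalS sNL (normal_sub nsLG) nsNG.
rewrite -(quotientGK nsNL).
have [|||->|->] := maxK (L / N)%G; try by [left | right].
- exact: quotient_normal.
- by rewrite -(cosetpreK Kb) quotientS.
- by rewrite -(cosetpreK Hb) quotientS.
Qed.

Lemma chief_factor_quotient G N K H :
    N <| G -> N \subset K -> chief_factor G K H ->
  chief_factor (G / N) (K / N) (H / N) /\ #|H / N : K / N| = #|H : K|.
Proof.
move=> nsNG sNK /chiefP[nsKG nsHG prKH maxK].
have nNG := normal_norm nsNG; have sKH := proper_sub prKH.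
have nNK := subset_trans (normal_sub nsKG) nNG.
have nNH := subset_trans (normal_sub nsHG) nNG.
have nsNK : N <| K by apply/andP.
have nsNH : N <| H by rewrite /normal nNH (subset_trans sNK).
split; last first.
  rewrite -[in RHS](quotientGK nsNK) -[in RHS](quotientGK nsNH).
  by rewrite index_morphpre ?sub_im_coset.
apply/chiefP; split; try exact: quotient_normal.
  by rewrite -cosetpre_proper !quotientGK.
move=> L nsLG; rewrite -(quotientGK nsNK) -(quotientGK nsNH) in maxK *.
move=> sKL sLH; have [|||eqL|eqL] := maxK (coset N @*^-1 L)%G.
- by rewrite -(quotientGK nsNG) cosetpre_normal.
- by rewrite /= quotientGK // -sub_quotient_pre.
- by rewrite cosetpreSK.
- by left; rewrite -[LHS]cosetpreK eqL cosetpreK.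
by right; rewrite -[LHS]cosetpreK eqL cosetpreK.
Qed.

Lemma prime_chief_quotient G N V U :
    N <| G -> V \subset U -> U <| G -> prime_chief G V U ->
  prime_chief (G / N) (V / N)%G (U / N)%G.
Proof.
move=> nsNG sVU nsUG pc Kb Hb ch sVK sHU.
have [ch' <-] := chief_factor_cosetpre nsNG ch.
have nNG := normal_norm nsNG.
have nNU := subset_trans (normal_sub nsUG) nNG.
apply: (prime_chief_join sVU nsUG nsNG pc ch').
  rewrite join_subG sub_cosetpre andbT -sub_quotient_pre //.
  exact: subset_trans sVU nNU.
by rewrite /= joingC norm_joinEr // -quotientK // cosetpreSK.
Qed.

Lemma prime_chief_cosetpre G N (Vb Ub : {group coset_of N}) :
  N <| G -> prime_chief (G / N) Vb Ub -> 
  prime_chief G (coset N @*^-1 Vb)%G (coset N @*^-1 Ub)%G.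
Proof.
move=> nsNG pc K H ch sVK sHU.
have sNK : N \subset K by apply: subset_trans sVK; apply: sub_cosetpre.
have [ch' <-] := chief_factor_quotient nsNG sNK ch.
apply: pc ch' _ _; first by rewrite -(cosetpreK Vb) quotientS.
by rewrite -(cosetpreK Ub) quotientS.
Qed.

Lemma prime_chief_lift G N :
  N <| G -> prime_chief (G / N) 1 (G / N)%G -> prime_chief G N G.
Proof.
move=> nsNG /(prime_chief_cosetpre nsNG); apply: prime_chiefS.
  by rewrite /= -[coset N @*^-1 1]/('ker (coset N)) ker_coset.
by rewrite /= quotientGK.
Qed.

End PrimeChiefQuotient.

(** * The supersoluble hypercenter *)

(** The image of H / K in the semidirect product X is normal in X, and since X
    acts on it as G does, it is minimal normal there: a chief factor of a
    supersoluble group. *)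
Lemma class_central_prime gT (G K H : {group gT}) :
  class_central supersoluble G K H -> prime #|H : K|.
Proof.
rewrite /class_central; case: {-}_ / idP => // ch /supersoluble_prime_chief pcX.
have /chiefP[nsKG nsHG _ _] := ch.
set to := <[chief_factor_acts ch]>%gact in pcX *.
set X := chief_sdprod ch in pcX *.
pose f := sdpair1 to; pose N := (f @* (H / K))%G.
have injf : 'injm f := injm_sdpair1 to.
have nKH : H \subset 'N(K) by rewrite (subset_trans (normal_sub nsHG)) ?normal_norm.
rewrite -card_quotient // -(card_injm injf) // -indexg1.
apply: pcX => //; last exact: subsetT.
rewrite (@chief_minnormal _ X N) ?subsetT //.
have /mingroupP[/andP[ntHK _] minHK] := chief_factor_minnormal ch.
apply/mingroupP; split=> [|L /andP[ntL nLX] sLN].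
  rewrite (morphim_injm_eq1 injf) // ntHK /=.
  rewrite -(im_sdpair to) mul_subG ?normG //.
  exact: im_sdpair_norm.
have sLimf : L \subset f @* (H / K) by [].
rewrite -(morphpreK (subset_trans sLimf (morphimS f (subxx _)))).
congr (f @* _); apply: (minHK (f @*^-1 L)%G); last exact: subsetIl.
rewrite -(morphim_injm_eq1 injf) ?subsetIl // morphpreK // ntL /=.
apply/subsetP=> _ /morphimP[g nKg Gg ->]; rewrite inE.
apply/subsetP=> _ /imsetP[x /morphpreP[HKx Lfx] ->].
have nHKg : g \in 'N(H) by rewrite (subsetP (normal_norm nsHG)).
have HKxg : x ^ coset K g \in H / K.
  by rewrite memJ_norm // (subsetP (quotient_norm _ _)) // mem_quotient.
rewrite mem_morphpre //= -(chief_actE ch HKx Gg).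
rewrite (sdpair_act to) ?mem_quotient // memJ_norm //.
by rewrite (subsetP nLX) ?inE.
Qed.

(** The product of two normal subgroups U and V whose chief factors have prime
    order inherits the property, since those above U are covered by V. *)
Lemma class_hypercenter_prime_chief gT (G : {group gT}) :
  class_hypercenter supersoluble G <| G
  /\ prime_chief G 1 (class_hypercenter supersoluble G).
Proof.
rewrite /class_hypercenter.
elim/big_ind: _ => [|U V [nsUG pcU] [nsVG pcV]|N /andP[nsNG /forallP allN]].
- by split; [apply: normal1 | apply: prime_chief_refl].
- split; first exact: normalY.
  apply: prime_chief_trans (nsUG) pcU _ (sub1G U) (joing_subl U V).
  have := prime_chief_join (sub1G V) nsVG nsUG pcV; apply: prime_chiefS.
    by rewrite join_subG sub1G /=.
  by rewrite /= joingC.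
split=> // K H ch _ sHN; apply: (@class_central_prime _ G).
by have /forallP/(_ H)/implyP := allN K; rewrite ch sHN => ->.
Qed.

(** * From s-permutability to normality *)

Lemma pgroup_p'group_eq1 gT (p : nat) (X : {group gT}) :
  p.-group X -> p^'.-group X -> X :=: 1.
Proof.
by move=> pX p'X; apply/eqP; rewrite trivg_card1; apply/eqP/(@pnat_1 p).
Qed.

Section SPermutable.

Variable gT : finGroupType.
Implicit Types G H K L M N P Q T X Y Z C : {group gT}.

Lemma sub_of_Sylows G X :
    (forall p, prime p -> exists2 Q : {group gT}, p.-Sylow(G) Q & Q \subset X) ->
  G \subset X.
Proof.
move=> sylX; have sIG := subsetIl G X.
suff : #|G : G :&: X| == 1%N by rewrite indexg_eq1 subsetI subxx.
apply: contraT => neq1; have pdv := pdiv_dvd #|G : G :&: X|.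
have p_pr : prime (pdiv #|G : G :&: X|).
  by rewrite pdiv_prime // ltn_neqAle eq_sym neq1 indexg_gt0.
have [Q /and3P[sQG pQ p'Q] sQX] := sylX _ p_pr.
have sQI : Q \subset G :&: X by rewrite subsetI sQG.
by rewrite p'natE // (dvdn_trans pdv) ?indexgS in p'Q.
Qed.

Lemma Sylow_lift p G N (Pb : {group coset_of N}) :
    N <| G -> p.-Sylow(G / N) Pb ->
  exists2 P : {group gT}, p.-Sylow(G) P & P / N = Pb.
Proof.
move=> nsNG sylPb; have nNG := normal_norm nsNG.
have [P sylP] := Sylow_exists p G; have sPG := pHall_sub sylP.
have sylPN := quotient_pHall (subset_trans sPG nNG) sylP.
have [_ /morphimP[x Nx Gx ->] ->] := Sylow_trans sylPN sylPb.
exists (P :^ x)%G; first by rewrite pHallJ.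
by rewrite quotientJ.
Qed.

(** As X permutes with every conjugate of P, it lies in all of them, that is in
    the normal p-subgroup W = gcore P G. For q <> p and Q a Sylow q-subgroup,
    X is the intersection of W with the group X * Q, so Q normalises X; and P
    does too by hypothesis. *)
Lemma s_permutable_pgroup_normal p G P X :
    p.-Sylow(G) P -> X <| P -> s_permutable G X -> X <| G.
Proof.
move=> sylP nsXP /andP[sXG /forallP permX].
have [sPG pP _] := and3P sylP; have [sXP nXP] := andP nsXP.
have pX := pgroupS sXP pP.
have permXQ Q : Sylow G Q -> commute X Q.
  by move=> sylQ; apply/eqP; have/implyP := permX Q; apply.
have sXcore : X \subset gcore P G.
  apply/bigcapsP=> x Gx; have sylPx : p.-Sylow(G) (P :^ x) by rewrite pHallJ.
  have com := permXQ (P :^ x)%G (p_Sylow sylPx).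
  suff <- : X <*> P :^ x = P :^ x by apply: joing_subl.
  apply: (sub_pHall sylPx); rewrite ?joing_subr // ?join_subG ?sXG ?(pHall_sub sylPx) //.
  by rewrite /= comm_joingE // pgroupM pX pgroupJ.
have pW := pgroupS (gcore_sub P G) pP.
have nsWG := gcore_normal sPG.
rewrite /normal sXG; apply: sub_of_Sylows => q q_pr.
have [-> | neq_qp] := eqVneq q p; first by exists P.
have [Q sylQ] := Sylow_exists q G; exists Q => //.
have com := permXQ Q (p_Sylow sylQ); have [sQG qQ _] := and3P sylQ.
suff defX : (X <*> Q) :&: gcore P G = X.
  rewrite /= -[in 'N(X)]defX normsI ?(subset_trans sQG (normal_norm nsWG)) //.
  exact: subset_trans (joing_subr X Q) (normG _).
rewrite comm_joingE // -group_modl // [Q :&: _]coprime_TIg ?mulg1 // coprime_sym.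
apply: pnat_coprime pW _.
by apply: sub_in_pnat qQ => r _ /=; rewrite !inE => /eqP->.
Qed.

End SPermutable.

Section ReducedQuasinormal.

Variable gT : finGroupType.
Implicit Types G H K L M N P Q T X Y Z C : {group gT}.

Lemma s_permutable_mul_normal p G P M T :
    p.-Sylow(G) P -> M <| P -> T <| G -> s_permutable G (M * T) ->
  M <*> T <| G.
Proof.
move=> sylP nsMP nsTG /andP[sMTG /forallP permMT].
have [sPG _ _] := and3P sylP; have [sMP nMP] := andP nsMP; have nTG := normal_norm nsTG.
have sMG := subset_trans sMP sPG; have nTM := subset_trans sMG nTG.
suff nsMTb : M / T <| G / T.
  by rewrite joingC norm_joinEr // -quotientK // -(quotientGK nsTG) cosetpre_normal.
apply: (s_permutable_pgroup_normal (quotient_pHall (subset_trans sPG nTG) sylP)).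
  exact: quotient_normal.
rewrite /s_permutable quotientS //; apply/forallP=> Qb.
apply/implyP=> /SylowP[q q_pr sylQb].
have [Q sylQ <-] := Sylow_lift nsTG sylQb.
have nTQ := subset_trans (pHall_sub sylQ) nTG.
have /implyP/(_ (p_Sylow sylQ))/eqP com := permMT Q.
rewrite -(quotientMl _ nTM) -(quotientMl _ nTQ).
rewrite -(quotientMidr T (M * Q)) -(quotientMidr T (Q * M)).
by rewrite -mulgA (normC nTQ) mulgA com mulgA.
Qed.

(** The form in which the hypothesis on maximal subgroups of Sylow subgroups is
    used. Allowing any normal C inside M, instead of the core of M, makes it
    stable under quotients, where the core may grow. *)
Definition reduced_quasinormal G M : Prop :=
  exists T Z C : {group gT},
    [/\ T <| G, M <*> T <| G, Z <| G & C <| G]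
    /\ [/\ C \subset M, C \subset Z, M :&: T \subset Z & prime_chief G C Z].

End ReducedQuasinormal.

Section ReducedQuasinormalTheory.

Variable gT : finGroupType.
Implicit Types G H K L M N P Q T X Y Z C : {group gT}.

(** Here C is the core of M, and Z the preimage of the hypercenter of G / C. *)
Lemma s_quasinormal_reduced p G P M :
  p.-Sylow(G) P -> M <| P -> s_quasinormal supersoluble G M -> reduced_quasinormal G M.
Proof.
move=> sylP nsMP /andP[sMG /existsP[T /and3P[nsTG permMT sMTZ]]].
have nsCG := gcore_normal sMG; have sCM := gcore_sub M G.
have [nsZb pcZ] := class_hypercenter_prime_chief (G / gcore M G).
exists T, (coset (gcore M G) @*^-1 class_hypercenter supersoluble (G / gcore M G))%G.
exists (gcore M G)%G.
split; first split=> //.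
- exact: s_permutable_mul_normal sylP nsMP nsTG permMT.
- by rewrite -[X in _ <| X](quotientGK nsCG) cosetpre_normal.
split=> //; first exact: sub_cosetpre.
  rewrite -sub_quotient_pre; last by rewrite subIset ?(subset_trans sMG (normal_norm nsCG)).
  by apply: subset_trans sMTZ; rewrite quotientS ?mulg_subl.
have := prime_chief_cosetpre nsCG pcZ; apply: prime_chiefS => //.
by rewrite /= -[coset _ @*^-1 1]/('ker (coset _)) ker_coset.
Qed.

Lemma reduced_quasinormal_normalS G K M :
  reduced_quasinormal G M -> M \subset K -> K <| G -> reduced_quasinormal K M.
Proof.
case=> T [Z [C [[nsT nsMT nsZ nsC] [sCM sCZ sMTZ pc]]]] sMK nsKG.
have sKG := normal_sub nsKG; have nsI X : X <| G -> X :&: K <| K.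
  move=> nsXG; rewrite /normal subsetIr normsI ?normG //.
  by rewrite (subset_trans sKG) ?normal_norm.
exists (T :&: K)%G, (Z :&: K)%G, C; split; split=> //; try exact: nsI.
- suff -> : M <*> (T :&: K) = (M <*> T) :&: K by apply: nsI.
  have nTM : M \subset 'N(T).
    by rewrite (subset_trans sMK) ?(subset_trans sKG) ?normal_norm.
  have nTKM : M \subset 'N(T :&: K) by rewrite normsI // (subset_trans sMK) ?normG.
  by rewrite (norm_joinEl nTM) (norm_joinEl nTKM) group_modl.
- by rewrite /normal (subset_trans sCM) // (subset_trans sKG) ?normal_norm.
- by rewrite subsetI sCZ (subset_trans sCM).
- by rewrite setIA setSI.
have := prime_chief_subG nsC nsZ sCZ sKG pc.
by apply: prime_chiefS; rewrite ?subsetIl.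
Qed.

(** The modular inclusion is what is needed for (M / N) :&: (T / N) to be
    controlled by M :&: T. *)
Lemma reduced_quasinormal_quotient G N M :
    N <| G -> M \subset G ->
    (forall T, T <| G -> M :&: (T <*> N) \subset (M :&: T) * N) ->
  reduced_quasinormal G M -> reduced_quasinormal (G / N) (M / N).
Proof.
move=> nsNG sMG modMN [T [Z [C [[nsT nsMT nsZ nsC] [sCM sCZ sMTZ pc]]]]].
have nNG := normal_norm nsNG; have nNM := subset_trans sMG nNG.
have nNT := subset_trans (normal_sub nsT) nNG.
exists (T / N)%G, (Z / N)%G, (C / N)%G.
split; split; rewrite ?quotient_normal ?quotientS //.
- by rewrite /= -quotientY // quotient_normal.
- rewrite /= -(quotientYidr nNT) -quotientIG ?joing_subr //.
  apply: subset_trans (quotientS N (modMN T nsT)) _.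
  by rewrite quotientMidr quotientS.
exact: prime_chief_quotient nsNG sCZ nsZ pc.
Qed.

End ReducedQuasinormalTheory.

Definition Sylow_maximals_quasinormal gT (p : nat) (G : {group gT}) : Prop :=
  forall P M : {group gT},
    p.-Sylow(G) P -> ~~ cyclic P -> maximal M P -> reduced_quasinormal G M.

(** A maximal subgroup of P / N is M / N for a maximal subgroup M of P. The
    modular inclusion holds by Dedekind's law if N is a p-group, since then
    N lies in M, and because T contains the p-subgroups of T <*> N if N is a
    p'-group. *)
Lemma Sylow_maximals_quasinormal_quotient gT (p : nat) (G N : {group gT}) :
    N <| G -> p.-group N \/ p^'.-group N ->
  Sylow_maximals_quasinormal p G -> Sylow_maximals_quasinormal p (G / N).
Proof.
move=> nsNG pp'N hypG Pb Mb sylPb ncycPb maxMb; have nNG := normal_norm nsNG.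
have [P sylP defPb] := Sylow_lift nsNG sylPb; have [sPG pP _] := and3P sylP.
have nNP := subset_trans sPG nNG.
have sMbPb : Mb \subset Pb by case/maxgroupp/andP: maxMb.
pose M := (P :&: coset N @*^-1 Mb)%G; have sMP : M \subset P := subsetIl _ _.
have sMG := subset_trans sMP sPG.
have defMb : M / N = Mb.
  by rewrite quotientIG ?sub_cosetpre // cosetpreK defPb; apply/setIidPr.
have maxM : maximal M P.
  apply/maxgroupP; split=> [|L /andP[sLP nsPL] sML].
    rewrite properE sMP; apply: contraL maxMb => sPM.
    apply/negP=> /maxgroupp/andP[_ /negP[]].
    by rewrite -defPb -defMb quotientS.
  have sLPb : L / N \subset Pb by rewrite -defPb quotientS.
  apply/eqP; rewrite eqEsubset sML andbT subsetI sLP /=.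
  rewrite -sub_quotient_pre ?(subset_trans sLP) //.
  have [eL|prL] := eqVproper sLPb; last first.
    have /maxgroupP[_ maxMb'] := maxMb.
    by rewrite (maxMb' (L / N)%G) // -defMb quotientS.
  case/negP: nsPL; have := subxx (P / N); rewrite {2}defPb -eL quotientSK // => sPNL.
  have sPNI : P :&: N \subset L by apply: subset_trans sML; rewrite setIS ?sub_cosetpre.
  by rewrite -(setIidPl sPNL) -group_modr // mul_subG.
have ncycP : ~~ cyclic P by apply: contra ncycPb => cycP; rewrite -defPb quotient_cyclic.
have := hypG P M sylP ncycP maxM.
rewrite (_ : Mb = (M / N)%G); last exact: group_inj.
apply: reduced_quasinormal_quotient => // T nsTG; have nTG := normal_norm nsTG.
have nNM := subset_trans sMG nNG; have nTN := subset_trans (normal_sub nsNG) nTG.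
case: pp'N => [pN | p'N].
  rewrite norm_joinEr // -group_modr // subsetI sub_cosetpre andbT.
  apply: subset_trans (pcore_sub_Hall sylP); apply: pcore_max pN nsNG.
apply: subset_trans (mulg_subl _ _) => //; rewrite subsetI subsetIl /=.
set I := M :&: _; have sIM : I \subset M := subsetIl _ _.
have nTI : I \subset 'N(T) by rewrite (subset_trans sIM) ?(subset_trans sMG).
rewrite -quotient_sub1 // subG1; apply/eqP/(@pgroup_p'group_eq1 _ p).
  exact/quotient_pgroup/(pgroupS sIM)/(pgroupS sMP).
apply: pgroupS (quotient_pgroup T p'N).
by rewrite /= -(quotientYidl nTN) quotientS ?subsetIr.
Qed.

Lemma Sylow_maximals_quasinormal_normalS gT p (G K : {group gT}) :
    K <| G -> (forall P : {group gT}, p.-Sylow(K) P -> p.-Sylow(G) P) ->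
  Sylow_maximals_quasinormal p G -> Sylow_maximals_quasinormal p K.
Proof.
move=> nsKG sylKG hypG P M sylP ncycP maxM.
apply: reduced_quasinormal_normalS (hypG P M (sylKG P sylP) ncycP maxM) _ nsKG.
have /andP[sMP _] := maxgroupp maxM; exact: subset_trans sMP (pHall_sub sylP).
Qed.

(** * Cyclic Sylow subgroups for the smallest prime *)

Section Burnside.

Variable gT : finGroupType.
Implicit Types G H K P U : {group gT}.

(** H / 'C_H(U) embeds in Aut U, of order p ^ n * (p - 1); it is a p'-group, so
    its order divides p - 1, but its prime divisors are at least p. *)
Lemma cyclic_smallest_cent p H U :
    prime p -> p.-group U -> cyclic U -> H \subset 'N(U) ->
    p^'.-nat #|H : 'C(U)| -> (forall q, prime q -> q %| #|H| -> p <= q) ->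
  H \subset 'C(U).
Proof.
move=> p_pr pU cycU nUH p'HC min_p.
suff : #|H : 'C(U)| == 1%N by rewrite indexg_eq1.
apply: contraT => neq1; have pdv := pdiv_dvd #|H : 'C(U)|.
have q_pr : prime (pdiv #|H : 'C(U)|).
  by rewrite pdiv_prime // ltn_neqAle eq_sym neq1 indexg_gt0.
set q := pdiv _ in pdv q_pr *.
have le_pq : p <= q by apply: min_p; rewrite // (dvdn_trans pdv) ?dvdn_indexg.
have neq_qp : q != p.
  by have := pnatP _ (indexg_gt0 _ _) p'HC q q_pr pdv.
have : q %| #|Aut U|.
  apply: dvdn_trans (cardSg (subset_trans (morphimS _ (subxx H)) (Aut_conj_aut U H))).
  by rewrite card_morphim ker_conj_aut (setIidPr nUH).
rewrite card_Aut_cyclic //.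
have [n ->] := p_natP pU; case: n => [|n]; first by rewrite Euclid_dvd1.
rewrite totient_pfactor // Euclid_dvdM // => /orP[].
  have p1_gt0 : 0 < p.-1 by rewrite -subn1 subn_gt0 prime_gt1.
  move/(dvdn_leq p1_gt0) => le_qp1.
  by rewrite -(prednK (prime_gt0 p_pr)) ltnNge le_qp1 in le_pq.
by rewrite Euclid_dvdX // dvdn_prime2 // (negbTE neq_qp).
Qed.

(** Burnside: if elements of the abelian P that are conjugate in G are equal,
    the transfer G -> P is the power map of exponent #|G : P| on P. That
    exponent is prime to p, so the kernel meets P trivially and is a normal
    complement. *)
Lemma transfer_controlled p G P :
    p.-Sylow(G) P -> abelian P ->
    {in P & G, forall u g, u ^ g \in P -> u ^ g = u} ->
  p^'.-Hall(G) 'O_p^'(G).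
Proof.
move=> sylP cPP ctrl; have [sPG pP p'GP] := and3P sylP.
have cPP' : abelian (idm_morphism P @* P) by rewrite im_idm.
pose tr := transfer_morphism G cPP'.
have trE x : x \in P -> fmval (tr x) = x ^+ #|G : P|.
  move=> Px; have Gx := subsetP sPG x Px.
  pose X := transversal (rcosets P G :* <[x]>) G.
  have trX : is_transversal X (rcosets P G :* <[x]>) G.
    exact/transversalP/rcosets_cycle_partition.
  rewrite /tr /= (transfer_cycle_expansion sPG cPP' Gx trX).
  rewrite -(sum_index_rcosets_cycle sPG Gx trX).
  have -> : x ^+ (\sum_(y in X) #|<[x]> : P :* y|)
            = \prod_(y in X) x ^+ #|<[x]> : P :* y|.
    by elim/big_rec2: _ => [|y a b _ <-]; rewrite ?expg0 // expgD.
  rewrite fmval_sum; apply: eq_bigr => y Xy.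
  have Gy := subsetP (transversal_sub trX) y Xy.
  have Pxy : (x ^+ #|<[x]> : P :* y|) ^ y^-1 \in P.
    have := mulg_exp_card_rcosets P x y; rewrite mem_rcoset.
    by rewrite conjgE invgK mulgA.
  rewrite (ctrl _ _ (groupX _ Px) (groupVr Gy) Pxy).
  by apply: (fmodK cPP'); rewrite /= morphim_idm // groupX.
pose f g := fmval (tr g).
have fM : {in G &, {morph f : x y / x * y}}.
  by move=> x y Gx Gy; rewrite /f morphM // fmvalA.
pose K := ('ker (Morphism fM))%G.
have nsKG : K <| G := ker_normal (Morphism fM).
have imP : Morphism fM @* G \subset P.
  apply/subsetP=> _ /morphimP[g _ Gg ->] /=.
  by have := fmodP (tr g); rewrite /= morphim_idm.
have pGK : p.-nat #|G : K|.
  rewrite -card_quotient ?normal_norm //.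
  rewrite (card_isog (first_isog (Morphism fM))).
  exact: pgroupS imP pP.
have tiPK : P :&: K = 1.
  apply/trivgP/subsetP=> x /setIP[Px /mker /=]; rewrite /f trE // => xm1.
  rewrite inE -order_eq1 -dvdn1 -(eqP (pnat_coprime (mem_p_elt pP Px) p'GP)).
  by rewrite dvdn_gcd dvdnn order_dvdn xm1 eqxx.
have p'K : p^'.-group K.
  have sylPK : p.-Sylow(K) (P :&: K) := Hall_setI_normal nsKG sylP.
  by have [_ _] := and3P sylPK; rewrite tiPK indexg1.
have hallK : p^'.-Hall(G) K by rewrite /pHall normal_sub // p'K pnatNK.
by rewrite (normal_Hall_pcore hallK).
Qed.

(** If u and u ^ g are in the cyclic group P, they generate the only subgroup of
    that order; so g normalises <[u]>, and centralises it by
    [cyclic_smallest_cent]. *)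
Lemma cyclic_Sylow_smallest_nilpotent p G P :
    prime p -> p.-Sylow(G) P -> cyclic P ->
    (forall q, prime q -> q %| #|G| -> p <= q) ->
  p^'.-Hall(G) 'O_p^'(G).
Proof.
move=> p_pr sylP cycP min_p; have [sPG pP p'GP] := and3P sylP.
have cPP := cyclic_abelian cycP.
apply: (transfer_controlled sylP cPP) => u g Pu Gg Pug.
have [sU sUg] : <[u]> \subset P /\ <[u ^ g]> \subset P by rewrite !cycle_subG.
have /eqP eqU : <[u]> :==: <[u ^ g]>.
  by rewrite (eq_subG_cyclic cycP) //= -!orderE orderJ.
have nUg : g \in 'N_G(<[u]>).
  by rewrite !inE Gg -cycleJ -eqU subxx.
have /subsetP/(_ g nUg) : 'N_G(<[u]>) \subset 'C(<[u]>).
  apply: (@cyclic_smallest_cent p); rewrite ?cycle_cyclic ?subsetIr //.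
  - exact: pgroupS sU pP.
  - rewrite -indexgI; apply: pnat_dvd p'GP.
    have sPC : P \subset 'N_G(<[u]>) :&: 'C(<[u]>).
      rewrite !subsetI sPG (subset_trans _ (cent_sub _)) ?sub_abelian_cent //.
    apply: dvdn_trans (indexgS _ sPC) _.
    rewrite indexSg ?subsetIl // subsetI sPG (subset_trans _ (cent_sub _)) //.
    exact: sub_abelian_cent.
  by move=> q q_pr qd; apply: min_p; rewrite // (dvdn_trans qd) ?cardSg ?subsetIl.
by move/centP/(_ u (cycle_id u)) => cgu; rewrite conjgE -cgu mulKg.
Qed.

End Burnside.

(** * Frattini arguments *)

Section Frattini.

Variable gT : finGroupType.
Implicit Types G H K L M N P Q S T X Y Z C : {group gT}.

Lemma pgroup_sub_index (p : nat) X N S :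
  N <| X -> S \subset X -> p.-group S -> p^'.-nat #|X : N| -> S \subset N.
Proof.
move=> /andP[sNX nNX] sSX pS p'XN.
have nNS := subset_trans sSX nNX.
rewrite -quotient_sub1 // subG1; apply/eqP/(@pgroup_p'group_eq1 _ p).
  exact: quotient_pgroup.
by apply: pgroupS (quotientS N sSX) _; rewrite /pgroup card_quotient.
Qed.

Lemma p'group_of_pgroups (p : nat) X :
  (forall S, S \subset X -> p.-group S -> S :=: 1) -> p^'.-group X.
Proof.
move=> pX1; have [S sylS] := Sylow_exists p X; have [sSX pS p'XS] := and3P sylS.
by rewrite (pX1 S sSX pS) indexg1 in p'XS.
Qed.

Lemma pnat_indexS (p : nat) G X Y :
  X <| G -> Y \subset G -> p.-nat #|G : X| -> p.-nat #|Y : X|.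
Proof.
move=> /andP[sXG nXG] sYG; apply: pnat_dvd.
have -> : #|Y : X| = #|X <*> Y : X|.
  by rewrite norm_joinEr ?(subset_trans sYG) // indexMg.
by rewrite indexSg ?joing_subl // join_subG sXG.
Qed.

(** Complements of N in X are conjugate under N by the Schur-Zassenhaus theorem,
    so N absorbs the action of G on them. *)
Lemma Hall_complement_Frattini (p : nat) G N X :
    N <| G -> X <| G -> N \subset X -> p.-group N -> p^'.-nat #|X : N| ->
  exists2 K : {group gT}, p^'.-Hall(X) K & N * 'N_G(K) = G.
Proof.
move=> nsNG nsXG sNX pN p'XN; have [sXG nXG] := andP nsXG; have [sNG nNG] := andP nsNG.
have nsNX : N <| X by rewrite /normal sNX (subset_trans sXG).
have hallN : p.-Hall(X) N by rewrite /pHall sNX pN.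
have /splitsP[K /complP[tiNK defX]] := SchurZassenhaus_split (pHall_Hall hallN) nsNX.
have hallK : p^'.-Hall(X) K.
  have sKX : K \subset X by rewrite -defX mulG_subr.
  rewrite /pHall sKX -divgS // -defX TI_cardMg // mulnK ?cardG_gt0 // pnatNK.
  rewrite -[_.-nat #|N|]/(p.-group N) pN andbT /pgroup.
  by rewrite -(mulKn #|K| (cardG_gt0 N)) -TI_cardMg // defX divgS.
exists K => //; apply/eqP; rewrite eqEsubset mul_subG ?subsetIl //=.
apply/subsetP=> g Gg.
have [sKX p'K _] := and3P hallK; have sKG := subset_trans sKX sXG.
have [|||||x Nx defKg] := @SchurZassenhaus_trans_sol _ N K (K :^ g).
- exact: pgroup_sol pN.
- exact: subset_trans sKG nNG.
- by rewrite defX -(normsP nXG g Gg) conjSg.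
- exact: pnat_coprime pN p'K.
- by rewrite cardJg.
rewrite -(normC (subset_trans (subsetIl _ _) nNG)) -[g](mulgKV x) mem_mulg //.
have Gx := subsetP sNG x Nx.
by rewrite inE groupM ?groupV //= inE conjsgM /= defKg conjsgK.
Qed.

(** A Sylow p-subgroup P1 of G containing one, P0, of Y satisfies P1 = N * P0.
    As N consists of non-generators of P1, this forces P0 = P1. *)
Lemma Frattini_Phi (p : nat) G N P Y :
    N <| G -> p.-Sylow(G) P -> N \subset 'Phi(P) -> Y \subset G -> N * Y = G ->
  N \subset Y.
Proof.
move=> nsNG sylP sNPhi sYG defG.
have [P0 sylP0] := Sylow_exists p Y; have [sP0Y pP0 _] := and3P sylP0.
have [P1 sylP1 sP01] := Sylow_superset (subset_trans sP0Y sYG) pP0.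
have sNPhi1 : N \subset 'Phi(P1).
  have [x Gx ->] := Sylow_trans sylP sylP1.
  by rewrite PhiJ -(normsP (normal_norm nsNG) x Gx) conjSg.
have sNP1 := subset_trans sNPhi1 (Phi_sub P1).
have [sP1G pP1 _] := and3P sylP1.
have defP1 : N * P0 = P1.
  rewrite -(setIidPr sP1G) -defG -group_modl //; congr (_ * _).
  rewrite (sub_pHall sylP0 _ _ (subsetIl Y P1)) //.
    exact: pgroupS (subsetIr _ _) pP1.
  by rewrite subsetI sP0Y.
apply: subset_trans sP0Y; rewrite -[P0 : {set gT}]genGid (@Phi_nongen _ P1) //.
apply/eqP; rewrite eqEsubset join_subG Phi_sub sP01 /= -{1}defP1.
by rewrite mul_subG ?joing_subr // (subset_trans sNPhi1) ?joing_subl.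
Qed.

End Frattini.

(** By [Hall_complement_Frattini] the preimage X of 'O_p^'(G / N) has a
    p-complement K with N * 'N_G(K) = G. If N normalises K, then K is a normal
    p'-subgroup of G, hence trivial, and X is N. *)
Lemma pcore_quotient_eq1 gT (p : nat) (G N : {group gT}) :
    N <| G -> p.-group N -> 'O_p^'(G) = 1 ->
    (forall K : {group gT}, K \subset G -> N * 'N_G(K) = G -> N \subset 'N(K)) ->
  'O_p^'(G / N) = 1.
Proof.
move=> nsNG pN Op'1 norm; pose X := (coset N @*^-1 'O_p^'(G / N))%G.
have nsXG : X <| G.
  by rewrite -[X in _ <| X](quotientGK nsNG) cosetpre_normal pcore_normal.
have sNX : N \subset X := sub_cosetpre _.
have XN : X / N = 'O_p^'(G / N) by rewrite /= cosetpreK.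
have nsNX : N <| X := normalS sNX (normal_sub nsXG) nsNG.
have p'XN : p^'.-nat #|X : N|.
  by rewrite -card_quotient ?normal_norm // XN; apply: pcore_pgroup.
have [K hallK defG] := Hall_complement_Frattini nsNG nsXG sNX pN p'XN.
have [sKX p'K _] := and3P hallK; have sKG := subset_trans sKX (normal_sub nsXG).
have nsKG : K <| G.
  by rewrite /normal sKG -{1}defG mul_subG ?subsetIr ?norm.
have K1 : K :=: 1 by apply/trivgP; rewrite -Op'1 pcore_max.
have pX : p.-group X by have [_ _] := and3P hallK; rewrite K1 indexg1 pnatNK.
rewrite -XN; apply: (@pgroup_p'group_eq1 _ p).
  exact: quotient_pgroup.
by rewrite /= XN; apply: pcore_pgroup.
Qed.

(** * Minimal normal p-subgroups outside the Frattini subgroup *)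

Section Monolith.

Variable gT : finGroupType.
Implicit Types G H K L M N P Q S T X Y Z C : {group gT}.

(** Choose M avoiding N. The subgroups C, T and Z attached to M are normal in G,
    so each of them is trivial or contains N. *)
Lemma monolith_prime (p : nat) G N P :
    N <| G -> minnormal N G -> p.-group N ->
    (forall Y, Y <| G -> Y :!=: 1 -> N \subset Y) ->
    p.-Sylow(G) P -> ~~ cyclic P -> Sylow_maximals_quasinormal p G ->
    ~~ (N \subset 'Phi(P)) ->
  prime #|N|.
Proof.
move=> nsNG minN pN mono sylP ncycP hypG notNPhi; have [sPG pP _] := and3P sylP.
have sNP : N \subset P := subset_trans (pcore_max pN nsNG) (pcore_sub_Hall sylP).
pose avoidN := [pred M : {group gT} | maximal M P && ~~ (N \subset M)].
have [M /andP[maxM notNM]| allM] := pickP avoidN; last first.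
  case/negP: notNPhi; apply/bigcapsP=> M /predU1P[-> //|maxM].
  by have := allM M; rewrite /= maxM => /negbFE.
have [T [Z [C [[nsT nsMT nsZ nsC] [sCM sCZ sMTZ pc]]]]] := hypG P M sylP ncycP maxM.
have idxM := p_maximal_index pP maxM; have nsMP := p_maximal_normal pP maxM.
have p_pr : prime p.
  by case: (pgroup_pdiv pP _) => //; apply: contraNneq ncycP => ->; apply: cyclic1.
(* If C were non-trivial it would contain N, while M does not. *)
have C1 : C :=: 1.
  by apply: contraNeq notNM => ntC; apply: subset_trans (mono C nsC ntC) sCM.
(* For T = 1 the maximal subgroup M itself would be normal, hence trivial. *)
have ntT : T :!=: 1.
  apply: contraNneq ncycP => T1; rewrite T1 joingG1 in nsMT.
  have M1 : M :=: 1 by apply: contraNeq notNM => ntM; apply: mono.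
  by rewrite prime_cyclic // -indexg1 -M1 idxM.
have sNT := mono T nsT ntT.
have [Z1 | ntZ] := eqVneq (Z : {set gT}) 1; last first.
  rewrite -indexg1; apply: pc; rewrite ?C1 ?mono //.
  by rewrite chief_minnormal ?normal_sub.
have MN1 : M :&: N = 1.
  by apply/trivgP; rewrite -Z1; apply: subset_trans sMTZ; rewrite setIS.
by rewrite -indexg1 -MN1 setIC indexgI -indexMg (mulg_normal_maximal nsMP) // idxM.
Qed.

End Monolith.

(** * p-nilpotency for the smallest prime *)

(** Suppose that G has neither normal p-subgroups nor normal p'-subgroups. Then
    C = 1; a minimal normal subgroup below Z would have prime order, so Z = 1
    and M :&: T = 1. The Sylow p-subgroups of T therefore have order at most p,
    T is p-nilpotent by the cyclic case, and so trivial. This makes M normal,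
    hence trivial, and P cyclic. *)
Lemma smallest_pcore_nontrivial gT (p : nat) (G P : {group gT}) :
    prime p -> (forall q, prime q -> q %| #|G| -> p <= q) ->
    Sylow_maximals_quasinormal p G -> 'O_p^'(G) = 1 ->
    p.-Sylow(G) P -> ~~ cyclic P ->
  'O_p(G) != 1.
Proof.
move=> p_pr min_p hypG Op'1 sylP ncycP; have [_ pP _] := and3P sylP.
have p'Y (Y : {group gT}) : Y <| G -> p^'.-group Y -> Y :=: 1.
  by move=> nsYG p'Y; apply/trivgP; rewrite -Op'1 pcore_max.
apply/eqP=> Op1.
have pY (Y : {group gT}) : Y <| G -> p.-group Y -> Y :=: 1.
  by move=> nsYG pY; apply/trivgP; rewrite -Op1 pcore_max.
have [P1 | [M maxM _]] := maximal_exists (sub1G P).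
  by rewrite -P1 cyclic1 in ncycP.
have [T [Z [C [[nsT nsMT nsZ nsC] [sCM sCZ sMTZ pc]]]]] := hypG P M sylP ncycP maxM.
have idxM := p_maximal_index pP maxM; have nsMP := p_maximal_normal pP maxM.
have pM := pgroupS (normal_sub nsMP) pP.
have C1 : C :=: 1 := pY C nsC (pgroupS sCM pM).
have Z1 : Z :=: 1.
  apply/eqP; apply/idPn=> ntZ.
  have [N minN sNZ] := minnormal_exists ntZ (normal_norm nsZ).
  have /andP[ntN nNG] := mingroupp minN.
  have sNG := subset_trans sNZ (normal_sub nsZ).
  have nsNG : N <| G by apply/andP.
  have prN : prime #|N|.
    by rewrite -indexg1; apply: pc; rewrite ?C1 ?chief_minnormal.
  case/negP: ntN; apply/eqP; have [eqNp | neqNp] := eqVneq #|N| p.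
    by apply: pY; rewrite // /pgroup eqNp pnat_id.
  by apply: p'Y; rewrite // /pgroup p'natE // dvdn_prime2 // eq_sym.
have cycPT : cyclic (P :&: T).
  have [sPTM | nsPTM] := boolP (P :&: T \subset M).
    have -> : P :&: T = 1; last exact: cyclic1.
    apply/trivgP; rewrite -Z1; apply: subset_trans sMTZ.
    by rewrite subsetI sPTM subsetIr.
  apply: prime_cyclic; have MT1 : M :&: (P :&: T) = 1.
    apply/trivgP; rewrite -Z1; apply: subset_trans sMTZ.
    by rewrite setIS ?subsetIr.
  rewrite -indexg1 -MT1 setIC indexgI -indexMg.
  by rewrite (mulg_normal_maximal nsMP) ?subsetIl // idxM.
have sylPT : p.-Sylow(T) (P :&: T) := Hall_setI_normal nsT sylP.
have hallT : p^'.-Hall(T) 'O_p^'(T).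
  apply: cyclic_Sylow_smallest_nilpotent sylPT cycPT _ => // q q_pr qd.
  by apply: min_p; rewrite // (dvdn_trans qd) ?cardSg ?normal_sub.
have Op'T1 : 'O_p^'(T) = 1.
  by apply: p'Y; rewrite ?pcore_pgroup // (char_normal_trans (pcore_char _ _)).
have T1 : T :=: 1.
  by apply: pY => //; have [_ _] := and3P hallT; rewrite Op'T1 indexg1 pnatNK.
rewrite T1 joingG1 in nsMT.
by case/negP: ncycP; rewrite prime_cyclic // -indexg1 -(pY M nsMT pM) idxM.
Qed.

(** In a minimal counterexample 'O_p^'(G) = 1, G has a minimal normal p-subgroup
    N, and G / L is p-nilpotent for all non-trivial normal p-subgroups L. If a
    normal subgroup Y <> 1 avoided N, it would embed in G / N and be a p-group,
    and G, embedded in the product of G / N and G / L for L inside Y, would be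
    p-nilpotent; so N is inside Y. Now a complement K as in
    [pcore_quotient_eq1] is normalised by N, either because N is inside
    'Phi(P), or because N has order p and is central in G, as p is the smallest
    prime divisor of #|G|. *)
Lemma smallest_p_nilpotent gT (p : nat) (G : {group gT}) :
    prime p -> (forall q, prime q -> q %| #|G| -> p <= q) ->
    Sylow_maximals_quasinormal p G ->
  p^'.-Hall(G) 'O_p^'(G).
Proof.
move=> p_pr; have [m] := ubnP #|G|; elim: m gT G => // m IHm gT G leGm min_p hypG.
have IHq (N : {group gT}) : N <| G -> N :!=: 1 -> p.-group N \/ p^'.-group N ->
    p^'.-Hall(G / N) 'O_p^'(G / N).
  move=> nsNG ntN pp'N; apply: IHm.
  - exact: leq_trans (ltn_quotient ntN (normal_sub nsNG)) leGm.
  - move=> q q_pr qd; apply: min_p; rewrite // (dvdn_trans qd) //.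
    exact: dvdn_quotient.
  exact: Sylow_maximals_quasinormal_quotient.
have [Op'1 | ntOp'] := eqVneq 'O_p^'(G) 1; last first.
  have nsOG := pcore_normal p^' G.
  have := IHq _ nsOG ntOp' (or_intror (pcore_pgroup _ _)).
  rewrite trivg_pcore_quotient => /and3P[_ _].
  rewrite indexg1 /= card_quotient ?normal_norm // => pGO.
  by rewrite /pHall pcore_sub pcore_pgroup.
have [P sylP] := Sylow_exists p G; have [sPG pP p'GP] := and3P sylP.
have [cycP | ncycP] := boolP (cyclic P).
  exact: cyclic_Sylow_smallest_nilpotent sylP cycP min_p.
have p'Y (Y : {group gT}) : Y <| G -> p^'.-group Y -> Y :=: 1.
  by move=> nsYG p'Y; apply/trivgP; rewrite -Op'1 pcore_max.
have ntOp := smallest_pcore_nontrivial p_pr min_p hypG Op'1 sylP ncycP.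
have [N minN sNOp] := minnormal_exists ntOp (gFnorm _ _).
have /andP[ntN nNG] := mingroupp minN.
have sNG := subset_trans sNOp (pcore_sub _ _).
have nsNG : N <| G by apply/andP.
have pN := pgroupS sNOp (pcore_pgroup _ _).
suff pG : p.-group G by rewrite Op'1 /pHall sub1G pgroup1 indexg1 pnatNK.
have liftN (L : {group gT}) : L <| G -> p.-group L -> L :!=: 1 ->
    exists X : {group gT}, [/\ X <| G, L \subset X, p^'.-nat #|X : L| & p.-nat #|G : X|].
  move=> nsLG pL ntL; have /and3P[_ p'O] := IHq L nsLG ntL (or_introl pL).
  rewrite pnatNK => pGO.
  exists (coset L @*^-1 'O_p^'(G / L))%G; split.
  - by rewrite -[X in _ <| X](quotientGK nsLG) cosetpre_normal pcore_normal.
  - exact: sub_cosetpre.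
  - by rewrite -card_quotient ?subsetIl //= cosetpreK.
  by rewrite -[X in #|X : _|](quotientGK nsLG) index_morphpre ?sub_im_coset.
apply/idPn=> npG.
have [X [nsXG sNX p'XN pGX]] := liftN N nsNG pN ntN.
have nsNX := normalS sNX (normal_sub nsXG) nsNG.
have mono (Y : {group gT}) : Y <| G -> Y :!=: 1 -> N \subset Y.
  move=> nsYG ntY; apply: contraR npG => notNY.
  have NY1 := minnormal_TI minN nsYG notNY.
  (* X / N is a p'-group, so p-subgroups of Y :&: X lie in N :&: Y = 1. *)
  have YX1 : Y :&: X = 1.
    apply: p'Y; first exact: normalI.
    apply: p'group_of_pgroups => S sSYX pS; apply/trivgP; rewrite -NY1 subsetI.
    move: sSYX; rewrite subsetI => /andP[-> sSX].
    by rewrite (pgroup_sub_index nsNX sSX pS p'XN).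
  have pY : p.-group Y.
    by rewrite /pgroup -indexg1 -YX1 indexgI (pnat_indexS nsXG) ?normal_sub.
  have [L minL sLY] := minnormal_exists ntY (normal_norm nsYG).
  have /andP[ntL nLG] := mingroupp minL.
  have nsLG : L <| G by rewrite /normal nLG (subset_trans sLY) ?normal_sub.
  have [X' [nsX'G sLX' p'X'L pGX']] := liftN L nsLG (pgroupS sLY pY) ntL.
  (* Likewise p-subgroups of X :&: X' lie in N :&: L, inside N :&: Y. *)
  have XX'1 : X :&: X' = 1.
    apply: p'Y; first exact: normalI.
    apply: p'group_of_pgroups => S; rewrite subsetI => /andP[sSX sSX'] pS.
    apply/trivgP; rewrite -NY1 subsetI (pgroup_sub_index nsNX sSX pS p'XN).
    have nsLX' := normalS sLX' (normal_sub nsX'G) nsLG.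
    exact: subset_trans (pgroup_sub_index nsLX' sSX' pS p'X'L) sLY.
  rewrite /pgroup -indexg1 -XX'1 -(@Lagrange_index _ G X) ?subsetIl ?normal_sub //.
  by rewrite pnatM pGX indexgI (pnat_indexS nsX'G) ?normal_sub.
have [_ _ pGN] := and3P (IHq N nsNG ntN (or_introl pN)).
suff Op'N1 : 'O_p^'(G / N) = 1.
  case/negP: npG; rewrite pnatNK Op'N1 indexg1 /= card_quotient // in pGN.
  by rewrite /pgroup -(Lagrange sNG) pnatM [p.-nat _]pN.
apply: (pcore_quotient_eq1 nsNG pN Op'1) => K sKG defG.
have [sNPhi | notNPhi] := boolP (N \subset 'Phi(P)).
  apply: subset_trans (subsetIr G _).
  exact: Frattini_Phi nsNG sylP sNPhi (subsetIl _ _) defG.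
have prN := monolith_prime nsNG minN pN mono sylP ncycP hypG notNPhi.
(* N has order p and is normal in P, so P centralises it, and then so does G. *)
have nsNP : N <| P.
  by rewrite /normal (subset_trans sPG) // (subset_trans sNOp) ?pcore_sub_Hall.
have sNZ : N \subset 'Z(P).
  by apply: prime_meetG => //; rewrite meet_center_nil // (pgroup_nil pP).
have cNG : G \subset 'C(N).
  apply: (cyclic_smallest_cent p_pr pN (prime_cyclic prN) nNG) => //.
  have sPC : P \subset G :&: 'C(N).
    by rewrite subsetI sPG centsC (subset_trans sNZ) ?subsetIr.
  by rewrite -indexgI; apply: pnat_dvd p'GP; rewrite indexgS.
by apply: subset_trans (cent_sub K); rewrite centsC (subset_trans sKG).
Qed.

(** * Abelian actions of exponent dividing p - 1 *)

Section ExponentAbelian.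

Variable gT : finGroupType.
Implicit Types G N : {group gT}.

(** On N, viewed as an irreducible module over 'F_p, the elements of G commute
    with one another and are roots of 'X^p - 'X, which splits into the distinct
    factors 'X - a with a in 'F_p. By Schur's lemma a non-scalar x would make
    all x - a invertible, contradicting that their product vanishes. So G acts
    by scalars and every line is a submodule. *)
Lemma minnormal_exponent_prime (p : nat) G N :
    prime p -> minnormal N G -> p.-abelem N -> G^`(1) \subset 'C(N) ->
    {in G, forall x, x ^+ p.-1 \in 'C(N)} ->
  prime #|N|.
Proof.
move=> p_pr minN abelN cNG' cNGp.
have /andP[ntN nNG] := mingroupp minN.
pose rG := abelem_repr abelN ntN nNG.
have irrG : mx_irreducible rG by apply/abelem_mx_irrP.
have kerE x : x \in G -> x \in 'C(N) -> rG x = 1%:M%R.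
  move=> Gx cNx; have : x \in rker rG by rewrite rker_abelem inE Gx.
  by case/rkerP.
have scalG x : x \in G -> is_scalar_mx (rG x).
  move=> Gx; apply/idPn=> nscal.
  have Ap : (rG x ^+ p = rG x)%R.
    rewrite -[X in (_ ^+ X)%R](prednK (prime_gt0 p_pr)) exprS -repr_mxX //.
    by rewrite (kerE _ (groupX _ Gx) (cNGp x Gx)) mulr1.
  have : horner_mx (rG x) ('X^#|'F_p| - 'X)%R = 0%R.
    by rewrite rmorphB rmorphXn /= horner_mx_X card_Fp // Ap subrr.
  rewrite finField_genPoly rmorph_prod => prod0.
  have /mulVmx : (0 : 'M['F_p]_('dim N))%R \in unitmx; last first.
    by rewrite mulmx0 => /eqP; rewrite eq_sym oner_eq0.
  rewrite -prod0; apply: (big_ind (fun B => B \in unitmx)) => [|A B uA uB|a _].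
  - exact: unitmx1.
  - by rewrite unitmx_mul uA.
  rewrite rmorphB [X in (X - _)%R]horner_mx_X [X in (_ - X)%R]horner_mx_C.
  apply: (mx_Schur irrG); last first.
    rewrite subr_eq0; apply: contraNneq nscal => eqA.
    have -> : rG x = (a%:M)%R by apply: eqA.
    exact: scalar_mx_is_scalar.
  apply/centgmxP=> y Gy; rewrite mulmxBl mulmxBr scalar_mxC; congr (_ - _)%R.
  rewrite -!repr_mxM //.
  have Gc : [~ x, y] \in G by rewrite groupR.
  have cNc : [~ x, y] \in 'C(N) by rewrite (subsetP cNG') ?mem_commg.
  by rewrite commgC (repr_mxM rG (groupM Gy Gx) Gc) (kerE _ Gc cNc) mulmx1.
have : \rank (<<delta_mx 0%R 0%R : 'rV['F_p]_('dim N)>>%MS) = 1%N.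
  by rewrite genmxE mxrank_delta.
set M := (X in \rank X) => rM.
have modM : mxmodule rG M.
  apply/mxmoduleP=> x /scalG/is_scalar_mxP[a ->].
  by rewrite scalar_mxC submxMl.
have /eqP : row_full M.
  by case/mx_irrP: irrG => _; apply; rewrite // -mxrank_eq0 rM.
rewrite rM => dimN.
have := card_abelem_rV abelN ntN; rewrite card_mx -dimN mul1n expn1 card_Fp // => <-.
by [].
Qed.

End ExponentAbelian.

(** * Soluble groups with trivial p'-core *)

Section SolvableCores.

Variable gT : finGroupType.
Implicit Types D E G H K L N R U X Y : {group gT}.

Lemma solvable_pcores_trivial (p : nat) G :
  solvable G -> 'O_p(G) = 1 -> 'O_p^'(G) = 1 -> G :=: 1.
Proof.
move=> solG Op1 Op'1; apply/eqP/idPn=> ntG.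
have [N minN sNG] := minnormal_exists ntG (normG G).
have [nNG ntN /is_abelemP[q q_pr abelN]] := minnormal_solvable minN sNG solG.
have nsNG : N <| G by apply/andP.
have qN := abelem_pgroup abelN.
case/eqP: ntN; apply/trivgP; have [eqp | neqp] := eqVneq q p.
  by rewrite -Op1 pcore_max // -eqp.
rewrite -Op'1 pcore_max //; apply: sub_in_pnat qN => r _ /=.
by rewrite !inE => /eqP->.
Qed.

(** Aut U is abelian of order p - 1. *)
Lemma prime_order_norm (p : nat) X U :
    prime p -> #|U| = p -> X \subset 'N(U) ->
  X^`(1) \subset 'C(U) /\ {in X, forall x, x ^+ p.-1 \in 'C(U)}.
Proof.
move=> p_pr oU nUX; have cycU : cyclic U by rewrite prime_cyclic ?oU.
have sAut := Aut_conj_aut U X.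
split=> [|x Xx].
  rewrite -ker_conj_aut -sub_morphim_pre ?morphim_der //; last first.
    exact: subset_trans (der_sub 1 X) nUX.
  by rewrite (subset_trans (dergS 1 sAut)) //= subG1; apply/eqP/derG1P/Aut_cyclic_abelian.
have nUx := subsetP nUX x Xx.
rewrite -ker_conj_aut; apply/kerP; first exact: groupX.
rewrite morphX //; have Ax : conj_aut U x \in Aut U by rewrite Aut_aut.
have := expg_cardG Ax.
by rewrite card_Aut_cyclic // oU totient_prime.
Qed.

End SolvableCores.

Section PcoreCentralizer.

Variable gT : finGroupType.
Implicit Types D E G H K L N R U X Y : {group gT}.

(** Coprime action: climbing a chief series of X below R, if E centralises K and
    H / K then 'C_H(E) covers H / K, so E centralises H. *)
Lemma coprime_chief_cent (p : nat) X R E :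
    R <| X -> p.-group R -> E \subset X -> p^'.-group E ->
    (forall K H, chief_factor X K H -> H \subset R -> [~: H, E] \subset K) ->
  E \subset 'C(R).
Proof.
move=> nsRX pR sEX p'E centE.
suff IH m (H : {group gT}) : #|H| < m -> H <| X -> H \subset R -> E \subset 'C(H).
  exact: IH nsRX (subxx _).
elim: m H => // m IHm H leHm nsHX sHR.
have [-> | ntH] := eqVneq (H : {set gT}) 1; first exact: cents1.
have pr1H : 1%G \proper H by rewrite proper1G.
have [K chKH _] := chief_exists (normal1 X) nsHX pr1H.
have /chiefP[nsKX _ prKH _] := chKH; have sKH := proper_sub prKH.
have nKE := subset_trans sEX (normal_norm nsKX).
have nHE := subset_trans sEX (normal_norm nsHX).
have cKE := IHm K (leq_trans (proper_card prKH) leHm) nsKX (subset_trans sKH sHR).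
have pK := pgroupS (subset_trans sKH sHR) pR.
have nKH : H \subset 'N(K) := subset_trans (normal_sub nsHX) (normal_norm nsKX).
have defq : 'C_H(E) / K = H / K.
  rewrite (coprime_norm_quotient_cent nHE nKE (pnat_coprime pK p'E) (pgroup_sol pK)).
  by apply/setIidPl; rewrite quotient_cents2 // centE.
have sKC : K \subset 'C_H(E) by rewrite subsetI sKH centsC.
rewrite centsC; apply: subset_trans (subsetIr H _).
by rewrite -(quotientSGK _ sKC) // defq.
Qed.

(** With C the centraliser and W its intersection with 'O_p(G), the quotient
    C / W has trivial p-core because W already contains 'O_p(C), and trivial
    p'-core because W is central in C. A soluble group without either core is
    trivial. *)
Lemma cent_pcore_sub (p : nat) G :
  solvable G -> 'O_p^'(G) = 1 -> 'C_G('O_p(G)) \subset 'O_p(G).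
Proof.
move=> solG Op'1; pose R := 'O_p(G)%G; pose C := 'C_G(R)%G; change (C \subset R).
have nsRG : R <| G := pcore_normal p G; have pR : p.-group R := pcore_pgroup p G.
have nsCG : C <| G by rewrite /normal subsetIl normsI ?normG // norms_cent ?normal_norm.
pose W := (R :&: C)%G; have nsWC : W <| C.
  rewrite /normal subsetIr normsI ?normG //.
  by rewrite (subset_trans (normal_sub nsCG)) ?normal_norm.
have pW : p.-group W := pgroupS (subsetIl _ _) pR.
have OpC : 'O_p(C) \subset W.
  rewrite subsetI pcore_sub andbT pcore_max ?pcore_pgroup //.
  exact: char_normal_trans (pcore_char _ _) nsCG.
suff CW1 : C / W = 1 :> {set _}.
  apply: subset_trans (subsetIl R C); rewrite -quotient_sub1 ?normal_norm //.
  by rewrite CW1.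
apply: (@solvable_pcores_trivial _ p (C / W)%G).
- exact: quotient_sol (solvableS (subsetIl _ _) solG).
- rewrite pquotient_pcore //; apply/trivgP.
  by rewrite quotient_sub1 // (subset_trans (pcore_sub _ _)) ?normal_norm.
apply: (pcore_quotient_eq1 nsWC pW) => [|K sKC _].
  apply/trivgP; rewrite -Op'1 pcore_max ?pcore_pgroup //.
  exact: char_normal_trans (pcore_char _ _) nsCG.
apply: subset_trans (cent_sub K); rewrite centsC (subset_trans sKC) //.
by rewrite (subset_trans (subsetIr G _)) // centS ?subsetIl.
Qed.

(** Commutators and (p - 1)-th powers act trivially on factors of order p. A
    p'-subgroup E of the normal subgroup D that they generate therefore
    centralises 'O_p(G), and is trivial by [cent_pcore_sub]; so D is a
    p-group. *)
Lemma prime_chief_pcore_exponent (p : nat) G :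
    prime p -> solvable G -> 'O_p^'(G) = 1 -> prime_chief G 1 'O_p(G)%G ->
  G^`(1) \subset 'O_p(G) /\ {in G, forall x, x ^+ p.-1 \in 'O_p(G)}.
Proof.
move=> p_pr solG Op'1 pc; pose A := [set x ^+ p.-1 | x in G].
pose D := (G^`(1) <*> <<A>>)%G.
have sAG : A \subset G by apply/subsetP=> _ /imsetP[x Gx ->]; apply: groupX.
have sDG : D \subset G by rewrite join_subG der_sub gen_subG.
suff sDO : D \subset 'O_p(G).
  split=> [|x Gx]; first exact: subset_trans (joing_subl _ _) sDO.
  by apply/(subsetP sDO)/(subsetP (joing_subr _ _))/mem_gen/imsetP; exists x.
have nsDG : D <| G by rewrite sub_der1_normal ?joing_subl.
apply: pcore_max nsDG.
have nsRG := pcore_normal p G; have pR := pcore_pgroup p G.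
have solD := solvableS sDG solG.
have [E hallE] := Hall_exists p^' solD; have [sED p'E _] := and3P hallE.
have sEG := subset_trans sED sDG.
suff cER : E \subset 'C('O_p(G)).
  have sER : E \subset 'O_p(G).
    by rewrite (subset_trans _ (cent_pcore_sub solG Op'1)) // subsetI sEG.
  have E1 : E :=: 1 := pgroup_p'group_eq1 (pgroupS sER pR) p'E.
  by have [_ _] := and3P hallE; rewrite E1 indexg1 pnatNK.
apply: (coprime_chief_cent nsRG pR sEG p'E) => K H chKH sHR.
have /chiefP[nsKG nsHG prKH _] := chKH.
have nKG := normal_norm nsKG; have nKH := subset_trans (normal_sub nsHG) nKG.
have pH := pgroupS sHR pR.
have oHK : #|H / K| = p.
  have prHK : prime #|H / K| by rewrite card_quotient //; apply: pc chKH (sub1G _) sHR.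
  have /= pHK : p.-group (H / K) := quotient_pgroup K pH.
  by have := pgroupP pHK _ prHK (dvdnn _); rewrite inE => /eqP.
have [cG' cGp] := prime_order_norm p_pr oHK (quotient_norms K (normal_norm nsHG)).
have nKE := subset_trans sEG nKG.
rewrite commGC -quotient_cents2 //; apply: subset_trans (quotientS K sED) _.
have nKD := subset_trans sDG nKG; have nKG' := subset_trans (der_sub 1 G) nKG.
rewrite sub_quotient_pre // join_subG; apply/andP; split.
  by rewrite -sub_quotient_pre // quotient_der.
rewrite gen_subG; apply/subsetP=> _ /imsetP[x Gx ->]; have nKx := subsetP nKG x Gx.
by rewrite mem_morphpre ?groupX //= morphX // cGp ?mem_quotient.
Qed.

(** N meets the centre of the p-group 'O_p(G) in a non-trivial normal subgroup
    of G, hence lies in that centre. *)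
Lemma minnormal_cent_pcore (p : nat) G N :
  minnormal N G -> N \subset 'O_p(G) -> 'O_p(G) \subset 'C(N).
Proof.
move=> /mingroupP[/andP[ntN nNG] minN] sNO.
have nNO := subset_trans (pcore_sub p G) nNG.
have nsNO : N <| 'O_p(G) by apply/andP.
have ntNZ := meet_center_nil (pgroup_nil (pcore_pgroup p G)) nsNO ntN.
rewrite centsC -(minN (N :&: 'Z('O_p(G)))%G) ?subsetIl //.
  exact: subset_trans (subsetIr _ _) (subsetIr _ _).
rewrite ntNZ normsI // (char_norm_trans (center_char _)) //.
exact: normal_norm (pcore_normal p G).
Qed.

End PcoreCentralizer.

(** * Supersolubility *)

Lemma minnormal_prime_chief gT (G N : {group gT}) :
  N <| G -> minnormal N G -> prime #|N| -> prime_chief G N G -> prime_chief G 1 G.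
Proof.
move=> nsNG /mingroupP[_ minN] prN pcNG.
apply: prime_chief_trans nsNG _ pcNG (sub1G N) (normal_sub nsNG) => K H ch _ sHN.
have /chiefP[nsKG nsHG prKH _] := ch.
have ntH : H :!=: 1 by rewrite -proper1G (sub_proper_trans (sub1G K)).
have eqHN : H :=: N by apply: minN; rewrite // ntH normal_norm.
suff K1 : K :=: 1 by rewrite eqHN K1 indexg1.
apply: contraTeq (prKH) => ntK; rewrite eqHN (minN K) ?properxx ?ntK ?normal_norm //.
exact: subset_trans (proper_sub prKH) sHN.
Qed.

Lemma prime_chief_solvable gT (G : {group gT}) : prime_chief G 1 G -> solvable G.
Proof.
have [m] := ubnP #|G|; elim: m gT G => // m IHm gT G leGm pc.
have [-> | ntG] := eqVneq (G : {set gT}) 1; first exact: solvable1.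
have [N minN sNG] := minnormal_exists ntG (normG G).
have /andP[ntN nNG] := mingroupp minN; have nsNG : N <| G by apply/andP.
have prN : prime #|N| by rewrite -indexg1; apply: pc; rewrite ?chief_minnormal.
rewrite (series_sol nsNG) abelian_sol ?cyclic_abelian ?prime_cyclic //=.
apply: IHm; first exact: leq_trans (ltn_quotient ntN sNG) leGm.
have := prime_chief_quotient nsNG (sub1G G) (normal_refl G) pc.
by apply: prime_chiefS; rewrite //= quotient1.
Qed.

Lemma pgroup_pgroup_or_p'group gT (p q : nat) (N : {group gT}) :
  p.-group N -> q.-group N \/ q^'.-group N.
Proof.
move=> pN; have [-> | neq_qp] := eqVneq q p; [by left | right].
by apply: sub_in_pnat pN => r _ /=; rewrite !inE => /eqP->; rewrite eq_sym.
Qed.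

(** By induction all proper quotients by minimal normal subgroups are
    supersoluble, so #|N| = p is all that is missing. Otherwise N is contained
    in every non-trivial normal subgroup Y, since a minimal normal N outside Y
    would be isomorphic to a chief factor of the supersoluble G / Y. By
    [monolith_prime] N is inside 'Phi(P), so 'O_p^'(G / N) = 1 and
    [prime_chief_pcore_exponent] applies to G / N. *)
Lemma solvable_prime_chief gT (G : {group gT}) :
  solvable G -> (forall p, Sylow_maximals_quasinormal p G) -> prime_chief G 1 G.
Proof.
have [m] := ubnP #|G|; elim: m gT G => // m IHm gT G leGm solG hypG.
have [G1 | ntG] := eqVneq (G : {set gT}) 1.
  by apply: prime_chief_refl; rewrite G1.
have minIH (L : {group gT}) : minnormal L G -> L \subset G ->
    exists p, [/\ prime p, p.-abelem L & prime_chief (G / L) 1 (G / L)%G].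
  move=> minL sLG.
  have [nLG ntL /is_abelemP[p p_pr abelL]] := minnormal_solvable minL sLG solG.
  have nsLG : L <| G by apply/andP.
  exists p; split=> //; apply: IHm.
  - exact: leq_trans (ltn_quotient ntL sLG) leGm.
  - exact: quotient_sol.
  move=> q; apply: Sylow_maximals_quasinormal_quotient (hypG q) => //.
  exact: pgroup_pgroup_or_p'group (abelem_pgroup abelL).
have [N minN sNG] := minnormal_exists ntG (normG G).
have /andP[ntN nNG] := mingroupp minN; have nsNG : N <| G by apply/andP.
have [p [p_pr abelN pcGN]] := minIH N minN sNG; have pN := abelem_pgroup abelN.
have pcNG := prime_chief_lift nsNG pcGN.
apply: (minnormal_prime_chief nsNG minN _ pcNG); apply/idPn=> nprN.
have mono (Y : {group gT}) : Y <| G -> Y :!=: 1 -> N \subset Y.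
  move=> nsYG ntY; apply: contraR nprN => notNY.
  have NY1 := minnormal_TI minN nsYG notNY.
  have [L minL sLY] := minnormal_exists ntY (normal_norm nsYG).
  have /andP[ntL nLG] := mingroupp minL; have sLG := subset_trans sLY (normal_sub nsYG).
  have nsLG : L <| G by apply/andP.
  have [_ [_ _ /(prime_chief_lift nsLG) pcLG]] := minIH L minL sLG.
  have chN : chief_factor G 1 N by rewrite chief_minnormal.
  have sNY1 : N :&: Y \subset 1%G by rewrite NY1.
  have [ch'] := chief_factor_joing chN nsYG sNY1.
  rewrite indexg1 => <-; apply: pcLG ch' _ _.
    exact: subset_trans sLY (joing_subr _ _).
  by rewrite join_subG sNG normal_sub.
have [P sylP] := Sylow_exists p G.
have sNP : N \subset P := subset_trans (pcore_max pN nsNG) (pcore_sub_Hall sylP).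
have ncycP : ~~ cyclic P.
  by apply: contra nprN => cycP; apply: minnormal_cyclic_prime minN (cyclicS sNP cycP).
have sNPhi : N \subset 'Phi(P).
  by apply: contraR nprN; apply: monolith_prime nsNG minN pN mono sylP ncycP (hypG p).
have Op'1 : 'O_p^'(G) = 1.
  apply: contraNeq ntN => ntO; apply/eqP/(pgroup_p'group_eq1 pN).
  exact: pgroupS (mono _ (pcore_normal _ _) ntO) (pcore_pgroup _ _).
have Op'N1 : 'O_p^'(G / N) = 1.
  apply: (pcore_quotient_eq1 nsNG pN Op'1) => K _ defG.
  apply: subset_trans (subsetIr G _).
  exact: Frattini_Phi nsNG sylP sNPhi (subsetIl _ _) defG.
have sNO : N \subset 'O_p(G) := pcore_max pN nsNG.
have pcO : prime_chief (G / N) 1 'O_p(G / N)%G.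
  by apply: prime_chiefS pcGN; rewrite ?pcore_sub.
have [] := prime_chief_pcore_exponent p_pr (quotient_sol N solG) Op'N1 pcO.
rewrite pquotient_pcore // => G'O GpO.
have cNO := minnormal_cent_pcore minN sNO.
case/negP: nprN; apply: (minnormal_exponent_prime p_pr minN abelN) => [|x Gx].
  apply: subset_trans cNO; have nNG' := subset_trans (der_sub 1 G) nNG.
  by rewrite -(quotientSGK nNG' sNO) quotient_der.
apply: (subsetP cNO); have nNx := subsetP nNG x Gx.
have nsNO : N <| 'O_p(G) by rewrite /normal sNO (subset_trans (pcore_sub _ _)).
rewrite -(quotientGK nsNO) mem_morphpre ?groupX //= morphX //.
by apply: GpO; apply: mem_quotient.
Qed.

(** For the smallest prime divisor p, the normal p-complement K of G inherits the
    hypothesis: its Sylow q-subgroups are Sylow in G for q <> p and trivial for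
    q = p. Being supersoluble by induction, it is soluble, and so is G. *)
Lemma Sylow_maximals_quasinormal_prime_chief gT (G : {group gT}) :
  (forall p, Sylow_maximals_quasinormal p G) -> prime_chief G 1 G.
Proof.
have [m] := ubnP #|G|; elim: m gT G => // m IHm gT G leGm hypG.
have [G1 | ntG] := eqVneq (G : {set gT}) 1.
  by apply: solvable_prime_chief => //; rewrite G1 solvable1.
apply: solvable_prime_chief => //.
have [p_pr pdv] : prime (pdiv #|G|) /\ (pdiv #|G| %| #|G|).
  by rewrite pdiv_prime ?pdiv_dvd // cardG_gt1.
set p := pdiv _ in p_pr pdv.
have hallK : p^'.-Hall(G) 'O_p^'(G).
  by apply: smallest_p_nilpotent => // q q_pr qd; apply: pdiv_min_dvd; rewrite ?prime_gt1.
have [sKG p'K pGK] := and3P hallK; rewrite pnatNK in pGK.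
have nsKG := pcore_normal p^' G.
rewrite (series_sol nsKG); apply/andP; split; last first.
  by apply: (@pgroup_sol _ p); rewrite /pgroup card_quotient ?normal_norm.
apply: prime_chief_solvable; apply: IHm => [|q].
  apply: leq_trans (proper_card _) leGm; rewrite properEneq sKG andbT.
  apply: contraTneq p'K => ->; rewrite /pgroup p'natE // pdv.
  by [].
have [-> | neq_qp] := eqVneq q p.
  move=> P M sylP; case/negP; suff -> : P :=: 1 by apply: cyclic1.
  apply: pgroup_p'group_eq1 (pHall_pgroup sylP) _.
  exact: pgroupS (pHall_sub sylP) p'K.
apply: Sylow_maximals_quasinormal_normalS nsKG _ (hypG q) => P sylP.
have [sPK qP q'KP] := and3P sylP.
rewrite /pHall (subset_trans sPK) // qP -(Lagrange_index sKG sPK) pnatM q'KP.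
rewrite andbT /=; apply: sub_in_pnat pGK => r _ /=.
by rewrite !inE => /eqP->; rewrite eq_sym.
Qed.

(** Each step of a subnormal series from A to G has index prime to p. *)
Lemma subnormal_sub_pgroup gT (p : nat) (G A P : {group gT}) :
  A <|<| G -> p^'.-nat #|G : A| -> P \subset G -> p.-group P -> P \subset A.
Proof.
have [m] := ubnP #|G|; elim: m G => // m IHm G leGm snA p'GA sPG pP.
have [-> // | [K [snAK nsKG prKG]]] := subnormalEr snA.
have sAK := subnormal_sub snAK; have sKG := normal_sub nsKG.
have [p'GK p'KA] : p^'.-nat #|G : K| /\ p^'.-nat #|K : A|.
  by apply/andP; rewrite -pnatM Lagrange_index.
apply: (IHm K) => //; first exact: leq_trans (proper_card prKG) leGm.
exact: pgroup_sub_index nsKG sPG pP p'GK.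
Qed.

Theorem theorem3p2 (gT : finGroupType) (G A B : {group gT})
    (defG : G = A * B :> {set gT})
    (snAG : A <|<| G)
    (hallB : Hall G B)
    (ssolB : supersoluble B)
    (cycSylB : forall P : {group gT}, Sylow B P -> cyclic P)
    (qnA : forall P M : {group gT}, Sylow A P -> ~~ cyclic P -> maximal M P ->
       s_quasinormal supersoluble G M) :
  supersoluble G.
Proof.
apply/supersoluble_prime_chief/Sylow_maximals_quasinormal_prime_chief.
move=> p P M sylP ncycP maxM.
have [sPG pP p'GP] := and3P sylP.
have /andP[sBG coB] := hallB.
have p_pr : prime p.
  by case: (pgroup_pdiv pP _) => //; apply: contraNneq ncycP => ->; apply: cyclic1.
have p'B : p^'.-group B.
  apply: contraR ncycP => npB.
  have [Q sylQ] := Sylow_exists p B; have [sQB pQ p'BQ] := and3P sylQ.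
  have p'GB : p^'.-nat #|G : B|.
    rewrite p'natE //; apply: contraL coB => pGB; rewrite /pgroup p'natE // negbK in npB.
    rewrite /coprime gtn_eqF // (leq_trans (prime_gt1 p_pr)) // dvdn_leq //.
      by rewrite gcdn_gt0 cardG_gt0.
    by rewrite dvdn_gcd npB.
  (* A Sylow p-subgroup of B is Sylow in G, so P would be cyclic like Q. *)
  have sylQG : p.-Sylow(G) Q.
    by rewrite /pHall (subset_trans sQB) // pQ -(Lagrange_index sBG sQB) pnatM p'GB.
  have [x _ ->] := Sylow_trans sylQG sylP.
  by rewrite cyclicJ cycSylB // (p_Sylow sylQ).
have sPA : P \subset A.
  apply: (@subnormal_sub_pgroup _ p G) => //.
  by rewrite [in #|_ : _|]defG indexMg; apply: pnat_dvd (dvdn_indexg _ _) p'B.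
have sylPA : Sylow A P.
  apply: (@p_Sylow _ p); rewrite /pHall sPA pP.
  by apply: pnat_dvd p'GP; rewrite indexSg // subnormal_sub.
have nsMP := p_maximal_normal pP maxM.
exact: s_quasinormal_reduced sylP nsMP (qnA P M sylPA ncycP maxM).
Qed.
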